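(* Let $\alpha\in(2/3,1)$. Then the closure in $\mathscr H^\alpha$ of the set $$ \{(h,h\circ Kh):\ h\in\mathcal H\} $$ is a strict subset of $\mathscr X^\alpha$.
   Context: $\mathbb T^2=(\mathbb R/2\pi\mathbb Z)^2$, $e_k(x)=e^{i\langle k,x\rangle}$, $k\in\mathbb Z^2$, and $\hat f(k)$ denotes the $k$-th Fourier coefficient of $f\in\mathscr S'(\mathbb T^2)$. Functions and distributions are real-valued. Let $\chi,\rho$ be nonnegative smooth radial functions on $\mathbb R^2$, $\chi$ supported in a ball, $\rho$ supported in an annulus, with $\chi+\sum_{j\ge0}\rho(2^{-j}\cdot)=1$, $\operatorname{supp}\chi\cap\operatorname{supp}\rho(2^{-j}\cdot)=\emptyset$ for $j\ge1$ and $\operatorname{supp}\rho(2^{-i}\cdot)\cap\operatorname{supp}\rho(2^{-j}\cdot)=\emptyset$ for $|i-j|>1$. Put $\Delta_{-1}f=\sum_k\chi(k)\hat f(k)e_k$ and $\Delta_jf=\sum_k\rho(2^{-j}k)\hat f(k)e_k$ for $j\ge0$. $\mathcal C^\beta(\mathbb T^2)$ is the space of $f\in\mathscr S'(\mathbb T^2)$ with $\|f\|_\beta=\sup_{j\ge-1}2^{j\beta}\|\Delta_jf\|_{L^\infty}<\infty$. The resonating term is $f\circ g=\sum_{i,j\ge-1,\ |i-j|\le1}\Delta_if\,\Delta_jg$. $\mathcal H=\{h\in L^2(\mathbb T^2):\int_{\mathbb T^2}h=0\}$; $\check{\mathcal C}^\infty(\mathbb T^2)$ is the set of smooth zero-mean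 functions; $K=(-\Delta)^{-1}$ acts on zero-mean distributions by $\widehat{K\theta}(k)=|k|^{-2}\hat\theta(k)$ for $k\neq0$, $\widehat{K\theta}(0)=0$. $\mathscr H^\alpha=\mathcal C^{\alpha-2}(\mathbb T^2)\times\mathcal C^{2\alpha-2}(\mathbb T^2)$ and $\mathscr X^\alpha$ is the closure in $\mathscr H^\alpha$ of $\{(\theta,\theta\circ K\theta-c):\theta\in\check{\mathcal C}^\infty(\mathbb T^2),\ c\in\mathbb R\}$. *)

(* Defs.v *)
From HB Require Import structures.
From mathcomp Require Import all_boot all_order all_algebra.
From mathcomp Require Import complex finmap.
From mathcomp Require Import all_classical all_reals all_analysis measurable_realfun.
From mathcomp Require Import ring lra zify.
Set Implicit Arguments.
Unset Strict Implicit.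
Unset Printing Implicit Defensive.
Import Order.TTheory GRing.Theory Num.Theory.
Import numFieldNormedType.Exports.
Local Open Scope classical_set_scope.
Local Open Scope ring_scope.

Section SmoothFunctions.
Variable R : realType.
Implicit Types (f : R * R -> R) (s : seq bool).

(* [false] is the first coordinate, [true] the second one. *)
Definition pslice (d : bool) f (x : R * R) : R -> R :=
  fun t => if d then f (x.1, t) else f (t, x.2).
Definition pcoord (d : bool) (x : R * R) : R := if d then x.2 else x.1.
Definition pderiv (d : bool) f : R * R -> R :=
  fun x => derive1 (pslice d f x) (pcoord d x).
Definition pderivs s f : R * R -> R := foldr pderiv f s.

Definition smooth f : Prop := forall s, continuous (pderivs s f) /\
  forall d x, derivable (pslice d (pderivs s f) x) (pcoord d x) 1.

Definition periodic2pi f : Prop :=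
  periodic f (pi *+ 2, 0) /\ periodic f (0, pi *+ 2).

Definition enorm (x : R * R) : R := Num.sqrt (x.1 ^+ 2 + x.2 ^+ 2).
Definition radial f : Prop := forall x y, enorm x = enorm y -> f x = f y.
Definition tsupp f : set (R * R) := closure [set x | f x != 0].
Definition dilate (j : nat) f : R * R -> R :=
  fun x => f (x.1 / 2 ^+ j, x.2 / 2 ^+ j).

Record dyadic_partition := DyadicPartition {
  chi : R * R -> R;
  rho : R * R -> R;
  chi_ge0 : forall x, 0 <= chi x;
  rho_ge0 : forall x, 0 <= rho x;
  chi_smooth : smooth chi;
  rho_smooth : smooth rho;
  chi_radial : radial chi;
  rho_radial : radial rho;
  chi_ball : exists r, tsupp chi `<=` [set x | enorm x <= r];
  rho_annulus : exists a b,
    0 < a < b /\ tsupp rho `<=` [set x | a <= enorm x <= b];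
  chi_rho_sum : forall x,
    chi x + \sum_(0 <= j < n) dilate j rho x @[n --> \oo] --> (1 : R);
  chi_rho_disj : forall j, (1 <= j)%N -> tsupp chi `&` tsupp (dilate j rho) = set0;
  rho_rho_disj : forall i j : nat, (1 < `|i - j|)%N ->
    tsupp (dilate i rho) `&` tsupp (dilate j rho) = set0 }.

Lemma pderivs_lin (a : R) f g s : smooth f -> smooth g ->
  pderivs s (a *: f + g) = a *: pderivs s f + pderivs s g.
Proof.
move=> sf sg; elim: s => [//|d s IH] /=; rewrite IH.
apply/funext => x; rewrite /pderiv.
have [_ df] := sf s; have [_ dg] := sg s.
have -> : pslice d (a *: pderivs s f + pderivs s g) x =
  a *: pslice d (pderivs s f) x + pslice d (pderivs s g) x.
  by apply/funext => t; rewrite /pslice; case: d {df dg}.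
rewrite !derive1E deriveD//; last exact: derivableZ.
by rewrite deriveZ//= -!derive1E.
Qed.

Lemma smooth_lin (a : R) f g : smooth f -> smooth g -> smooth (a *: f + g).
Proof.
move=> sf sg s; rewrite pderivs_lin//.
have [cf df] := sf s; have [cg dg] := sg s; split=> [x|d x].
  by apply: cvgD; [apply: cvgZr; exact: cf|exact: cg].
have -> : pslice d (a *: pderivs s f + pderivs s g) x =
  a *: pslice d (pderivs s f) x + pslice d (pderivs s g) x.
  by apply/funext => t; rewrite /pslice; case: d {df dg}.
by apply: derivableD => //; exact: derivableZ.
Qed.

Lemma pderivs_cst0 s : pderivs s (0 : R * R -> R) = 0.
Proof.
elim: s => [//|d s IH] /=; rewrite IH; apply/funext => x.
rewrite /pderiv (_ : pslice d 0 x = cst 0) ?derive1_cst//.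
by apply/funext => t; rewrite /pslice; case: d.
Qed.

Lemma smooth0 : smooth (0 : R * R -> R).
Proof.
move=> s; rewrite pderivs_cst0; split=> [x|d x]; first exact: cvg_cst.
rewrite (_ : pslice d 0 x = cst 0); first exact: derivable_cst.
by apply/funext => t; rewrite /pslice; case: d.
Qed.

Definition test_pred : {pred R * R -> R} :=
  mem [set f : R * R -> R | smooth f /\ periodic2pi f].

Lemma test_submod_closed : submod_closed test_pred.
Proof.
split; first by rewrite inE; split; [exact: smooth0|].
move=> a f g; rewrite !inE => -[sf pf] [sg pg]; split; first exact: smooth_lin.
have [f1 f2] := pf; have [g1 g2] := pg.
by split=> x; rewrite !fctE ?f1 ?f2 ?g1 ?g2.
Qed.
HB.instance Definition _ :=
  GRing.isSubmodClosed.Build R (R * R -> R) test_pred test_submod_closed.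

Record test := Test { test_fun :> R * R -> R; _ : test_fun \in test_pred }.
HB.instance Definition _ := [isSub for test_fun].
HB.instance Definition _ := [Choice of test by <:].
HB.instance Definition _ := [SubChoice_isSubLmodule of test by <:].

Definition angle (k : int * int) (x : R * R) : R :=
  k.1%:~R * x.1 + k.2%:~R * x.2.

Definition trig (k : int * int) (a b : R) : R * R -> R :=
  fun x => a * cos (angle k x) + b * sin (angle k x).

Lemma is_derive_trig k a b d x :
  is_derive (pcoord d x) 1 (pslice d (trig k a b) x)
    (trig k (b * (if d then k.2 else k.1)%:~R)
            (- a * (if d then k.2 else k.1)%:~R) x).
Proof.
set m : R := (if d then k.2 else k.1)%:~R.
pose c := angle k x - m * pcoord d x.
have aE t : angle k (if d then (x.1, t) else (t, x.2)) = m * t + c.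
  by rewrite /c /m /angle /pcoord; case: d {m c} => /=; ring.
have -> : pslice d (trig k a b) x =
    a *: (cos \o (fun t : R => m * t + c)) + b *: (sin \o (fun t => m * t + c)).
  by apply/funext => t; rewrite /pslice /trig/= !fctE/= -!aE; case: d {aE m c}.
have dl : is_derive (pcoord d x) (1 : R) (fun t : R => m * t + c) m.
  have e : m *: (1 : R) + 0 = m by rewrite addr0 /GRing.scale/= mulr1.
  by rewrite -[m in is_derive _ _ _ m]e; exact: is_deriveD.
rewrite /trig; have -> : angle k x = m * pcoord d x + c by rewrite /c addrC subrK.
apply: is_derive_eq.
by rewrite /GRing.scale/=; ring.
Qed.

Lemma pderivs_trig k s a b : exists a' b', pderivs s (trig k a b) = trig k a' b'.
Proof.
elim: s => [|d s [a' [b' IH]]] /=; first by exists a, b.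
rewrite IH; do 2 eexists; apply/funext => x.
have ? := is_derive_trig k a' b' d x.
by rewrite /pderiv derive1E derive_val.
Qed.

Lemma continuous_angle k : continuous (angle k).
Proof.
move=> x; apply: cvgD; apply: cvgM; try exact: cvg_cst.
  exact: cvg_fst.
exact: cvg_snd.
Qed.

Lemma continuous_trig k a b : continuous (trig k a b).
Proof.
move=> x; apply: cvgD; apply: cvgM; try exact: cvg_cst.
  exact: (continuous_comp (@continuous_angle k x) (@continuous_cos _ _)).
exact: (continuous_comp (@continuous_angle k x) (@continuous_sin _ _)).
Qed.

Lemma periodicz (f : R -> R) (T : R) (m : int) :
  periodic f T -> periodic f (m%:~R * T).
Proof.
move=> pf u; case: m => n; first by rewrite -[_%:~R]/(n%:R) mulr_natl periodicn.
rewrite NegzE mulrNz mulNr -[_%:~R]/(n.+1%:R) mulr_natl.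
by rewrite -(periodicn pf n.+1 (u - _)) subrK.
Qed.

Lemma test_trig k a b : trig k a b \in test_pred.
Proof.
rewrite inE; split.
  move=> s; have [a' [b' ->]] := pderivs_trig k s a b.
  by split=> [|d x]; [exact: continuous_trig|have [] := is_derive_trig k a' b' d x].
have pc m := periodicz m (@cosD2pi R); have ps m := periodicz m (@sinD2pi R).
split=> x; rewrite /trig /angle/=.
  have -> : k.1%:~R * (x.1 + pi *+ 2) + k.2%:~R * (x.2 + 0) =
    (k.1%:~R * x.1 + k.2%:~R * x.2) + k.1%:~R * (pi *+ 2) :> R by ring.
  by rewrite pc ps.
have -> : k.1%:~R * (x.1 + 0) + k.2%:~R * (x.2 + pi *+ 2) =
  (k.1%:~R * x.1 + k.2%:~R * x.2) + k.2%:~R * (pi *+ 2) :> R by ring.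
by rewrite pc ps.
Qed.

Definition cos_test k : test := Test (test_trig k 1 0).
Definition sin_test k : test := Test (test_trig k 0 1).

Definition distr_order_le (u : test -> R) (N : nat) (C : R) : Prop :=
  forall (phi : test) (M : R),
    (forall s x, (size s <= N)%N -> `|pderivs s phi x| <= M) -> `|u phi| <= C * M.

(* Continuity of a linear form for the Frechet topology of the test space
   amounts to a bound by one of the seminorms sup_(|s| <= N) |D^s phi|. *)
Definition distr_pred : {pred test -> R} :=
  mem [set u : test -> R | scalar u /\ exists N C, distr_order_le u N C].

Lemma distr_submod_closed : submod_closed distr_pred.
Proof.
split.
  rewrite inE; split; first by move=> a f g; rewrite -[RHS]/(a * 0 + 0 : R) mulr0 addr0.
  by exists 0%N, 0 => phi M _; rewrite -[X in `|X|]/(0 : R) normr0 mul0r.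
move=> a u v; rewrite !inE => -[lu [N1 [C1 b1]]] [lv [N2 [C2 b2]]]; split.
  by move=> c f g; rewrite !fctE lu lv /GRing.scale/=; ring.
exists (maxn N1 N2), (`|a| * C1 + C2) => phi M hM.
have h1 : `|u phi| <= C1 * M.
  by apply: b1 => s x h; apply: hM; rewrite leq_max h.
have h2 : `|v phi| <= C2 * M.
  by apply: b2 => s x h; apply: hM; rewrite leq_max h orbT.
rewrite !fctE (le_trans (ler_normD _ _))// mulrDl lerD// -mulrA normrM.
exact: ler_wpM2l.
Qed.
HB.instance Definition _ :=
  GRing.isSubmodClosed.Build R (test -> R) distr_pred distr_submod_closed.

Record distr := Distr { distr_fun :> test -> R; _ : distr_fun \in distr_pred }.
HB.instance Definition _ := [isSub for distr_fun].
HB.instance Definition _ := [Choice of distr by <:].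
HB.instance Definition _ := [SubChoice_isSubLmodule of distr by <:].

End SmoothFunctions.

Section TorusMeasure.
Variable R : realType.

Definition square : set (R * R) := `[0, pi *+ 2] `*` `[0, pi *+ 2].

Lemma measurable_square : measurable square.
Proof. by apply: measurableX; exact: measurable_itv. Qed.

(* T^2 is modelled by a fundamental domain; its measure has total mass
   (2 pi)^2. *)
Definition torus : 
    {measure set (measurableTypeR R * measurableTypeR R) -> \bar R} :=
  mrestr (lebesgue_measure \x lebesgue_measure)%E measurable_square.

End TorusMeasure.


Section Besov.
Variable R : realType.
Local Open Scope complex_scope.
Implicit Types (P : dyadic_partition R) (f g w : distr R) (k : int * int).

Definition expi k (x : R * R) : R[i] := cos (angle k x) +i* sin (angle k x).

(* (2 pi)^-2 <f, e_(-k)>, so that the Fourier series of f is sum_k fourier f k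
   e_k and that of an integrable function is the usual one. *)
Definition fourier f k : R[i] :=
  (((pi *+ 2) ^- 2)%:C) * (f (cos_test R k) -i* f (sin_test R k)).

(* Blocks are numbered from 0: [lp_block P 0] is Delta_(-1) and
   [lp_block P n.+1] is Delta_n. *)
Definition lp_mult P (n : nat) k : R :=
  let x : R * R := (k.1%:~R, k.2%:~R) in
  if n is j.+1 then dilate j (rho P) x else chi P x.

(* The support in k is finite. The sum is real because f is real and the
   multipliers are even, so taking the real part only changes the type. *)
Definition lp_block P n f (x : R * R) : R :=
  complex.Re (\sum_(k \in [set: int * int])
    ((lp_mult P n k)%:C * fourier f k * expi k x)).

Definition besov_norm P (beta : R) f : \bar R :=
  ereal_sup (range (fun n : nat => (2 `^ ((n%:R - 1) * beta))%:E *
    'N[torus R]_+oo [EFin \o (lp_block P n f : measurableTypeR R * measurableTypeR R -> R)])%E).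

Lemma finite_int_box (N : nat) :
  finite_set [set k : int * int | (`|k.1| <= N)%N /\ (`|k.2| <= N)%N].
Proof.
have fI : finite_set [set m : int | (`|m| <= N)%N].
  apply: (@sub_finite_set _ _ ((fun n : nat => n%:Z - N%:Z) @` `I_(N + N).+1)).
    move=> m /= hm; exists (absz (m + N%:Z)%R); first by rewrite /=; lia.
    by lia.
  exact/finite_image/finite_II.
apply: (sub_finite_set _ (finite_setX fI fI)).
by move=> [a b] /=.
Qed.

Lemma lp_mult_finite P n :
  exists A : {fset int * int}, forall k, k \notin A -> lp_mult P n k = 0.
Proof.
suff [N hN] : exists N : nat, forall k, lp_mult P n k != 0 ->
    (`|k.1| <= N)%N /\ (`|k.2| <= N)%N.
  exists (fset_set [set k : int * int | (`|k.1| <= N)%N /\ (`|k.2| <= N)%N]) => k.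
  rewrite in_fset_set; last exact: finite_int_box.
  by apply: contraNeq => /hN h; rewrite inE.
have coord (z : R * R) r : enorm z <= r -> `|z.1| <= r /\ `|z.2| <= r.
  move=> h; have a0 (u v : R) : `|u| <= Num.sqrt (u ^+ 2 + v ^+ 2).
    by rewrite -sqrtr_sqr ler_sqrt ?lerDl ?addr_ge0 ?sqr_ge0.
  split; apply: le_trans h; first exact: a0.
  by rewrite /enorm addrC; exact: a0.
have ib (m : int) (r : R) : `|m%:~R : R| <= r -> (`|m| <= Num.bound r)%N.
  move=> h; have r0 : 0 <= r by rewrite (le_trans _ h).
  have : `|m|%N%:R < (Num.bound r)%:R :> R.
    rewrite (le_lt_trans _ (archi_boundP r0))// (le_trans _ h)//.
    by rewrite -intr_norm -abszE.
  by rewrite ltr_nat => /ltnW.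
case: n => [|j] /=.
  have [r hr] := chi_ball P; exists (Num.bound r) => k kP.
  have /hr/coord[h1 h2] : tsupp (chi P) (k.1%:~R, k.2%:~R) by exact: subset_closure.
  by split; apply: ib.
have [a [b [_ hb]]] := rho_annulus P; exists (Num.bound (2 ^+ j * b)) => k.
rewrite /dilate/= => kP.
have /hb/andP[_ /coord[/= h1 h2]] :
  tsupp (rho P) (k.1%:~R / 2 ^+ j, k.2%:~R / 2 ^+ j) by exact: subset_closure.
have p : 0 < 2 ^+ j :> R by rewrite exprn_gt0.
by split; apply: ib; [move: h1|move: h2];
  rewrite normrM (gtr0_norm (x := (2 ^+ j)^-1)) ?invr_gt0// ler_pdivrMr// mulrC.
Qed.

Lemma lp_blockE P n : exists s : seq (int * int), forall f x,
  lp_block P n f x = \sum_(k <- s) lp_mult P n k * (pi *+ 2) ^- 2 *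
    (f (cos_test R k) * cos (angle k x) + f (sin_test R k) * sin (angle k x)).
Proof.
have [A hA] := lp_mult_finite P n; exists A => f x.
rewrite /lp_block (@fsbigTE _ _ _ _ A); last first.
  by move=> k kA; rewrite hA// !mul0r.
rewrite raddf_sum; apply: eq_bigr => k _ /=.
by rewrite /fourier/=; ring.
Qed.

Lemma lp_blockB P n f g x :
  lp_block P n (f - g) x = lp_block P n f x - lp_block P n g x.
Proof.
have [s E] := lp_blockE P n; rewrite !E -sumrB; apply: eq_bigr => k _.
have h t : (f - g : distr R) t = f t - g t by [].
by rewrite !h; ring.
Qed.


Lemma measurable_lp_block P n f :
  measurable_fun [set: measurableTypeR R * measurableTypeR R] (lp_block P n f).
Proof.
have [s E] := lp_blockE P n.
pose h k (x : measurableTypeR R * measurableTypeR R) : R :=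
  lp_mult P n k * (pi *+ 2) ^- 2 *
    (f (cos_test R k) * cos (angle k x) + f (sin_test R k) * sin (angle k x)).
have -> : lp_block P n f = fun x => \sum_(k <- s) h k x.
  by apply/funext => x; exact: E.
refine (@measurable_sum _ _ _ _ _ s h _) => k.
have ma : measurable_fun [set: measurableTypeR R * measurableTypeR R] (angle k).
  by apply: measurable_funD; apply: measurable_funM => //.
apply: measurable_funM => //; apply: measurable_funD; apply: measurable_funM => //.
  by apply: measurableT_comp ma; apply: continuous_measurable_fun; exact: continuous_cos.
by apply: measurableT_comp ma; apply: continuous_measurable_fun; exact: continuous_sin.
Qed.

Lemma besov_norm0 P beta : besov_norm P beta 0 = 0%E.
Proof.
rewrite /besov_norm (_ : [set _ | _ in _] = [set 0%E]) ?ereal_sup1//.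
have z n : lp_block P n 0 = cst 0.
  have [s E] := lp_blockE P n.
  apply/funext => x; rewrite E big1// => k _.
  have h t : (0 : distr R) t = 0 by [].
  by rewrite !h !mul0r addr0 mulr0.
apply/seteqP; split=> [_ [n _ <-]|_ ->].
  by rewrite z (_ : EFin \o _ = cst 0%E)// Lnorm0 ?mule0// eqe oner_neq0.
by exists 0%N => //; rewrite z (_ : EFin \o _ = cst 0%E)// Lnorm0 ?mule0.
Qed.

Lemma besov_normN P beta f : besov_norm P beta (- f) = besov_norm P beta f.
Proof.
congr ereal_sup; apply: eq_imagel => n _; congr (_ * _)%E.
rewrite -oppe_Lnorm; apply: eq_Lnorm => x /=.
have b0 : lp_block P n 0 x = 0.
  by have := lp_blockB P n 0 0 x; rewrite !subrr.
by have := lp_blockB P n 0 f x; rewrite !sub0r b0 sub0r => ->; rewrite ?EFinN ?oppeK ?opprK.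
Qed.

Lemma le_besov_normD P beta f g :
  (besov_norm P beta (f + g)%R <= besov_norm P beta f + besov_norm P beta g)%E.
Proof.
apply: ge_ereal_sup => _ [n _ <-].
have -> : EFin \o (lp_block P n (f + g)%R) =
    EFin \o (lp_block P n f \+ lp_block P n g)%R.
  apply/funext => x /=; congr EFin.
  have e : f = (f + g) - g by rewrite addrK.
  by rewrite [in X in _ = X + _]e lp_blockB subrK.
have w0 : (0 <= (2 `^ ((n%:R - 1) * beta))%:E :> \bar R)%E.
  by rewrite lee_fin powR_ge0.
have m1 := measurable_lp_block P n f; have m2 := measurable_lp_block P n g.
rewrite (le_trans (lee_wpmul2l w0 (eminkowski (torus R) m1 m2 (leey _))))//.
rewrite ge0_muleDr ?Lnorm_ge0// leeD//; apply: ereal_sup_ubound;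
  by exists n.
Qed.

Record besov P (beta : R) := Besov {
  besov_distr :> distr R;
  _ : besov_norm P beta besov_distr \is a fin_num }.
HB.instance Definition _ P beta := [isSub for @besov_distr P beta].
HB.instance Definition _ P beta := [Choice of besov P beta by <:].

Definition besov_ball P beta (u : besov P beta) (r : R) (v : besov P beta) : Prop :=
  (besov_norm P beta (besov_distr u - besov_distr v)%R < r%:E)%E.

Lemma besov_ball_center P beta (u : besov P beta) (r : R) :
  0 < r -> besov_ball u r u.
Proof. by move=> r0; rewrite /besov_ball subrr besov_norm0 lte_fin. Qed.

Lemma besov_ball_sym P beta (u v : besov P beta) (r : R) :
  besov_ball u r v -> besov_ball v r u.
Proof. by rewrite /besov_ball -besov_normN opprB. Qed.

Lemma besov_ball_triangle P beta (u v w : besov P beta) (r1 r2 : R) :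
  besov_ball u r1 v -> besov_ball v r2 w -> besov_ball u (r1 + r2) w.
Proof.
rewrite /besov_ball => h1 h2.
rewrite -[X in besov_norm _ _ (X - _)](subrK (besov_distr v)) -addrA.
by rewrite (le_lt_trans (le_besov_normD _ _ _ _))// EFinD lteD.
Qed.

(* The topology of C^beta is that of the distance besov_norm (u - v). *)
HB.instance Definition _ P beta := hasNbhs.Build (besov P beta)
  (nbhs_ (entourage_ (@besov_ball P beta))).
HB.instance Definition _ P beta := Nbhs_isPseudoMetric.Build R (besov P beta)
  erefl (@besov_ball_center P beta) (@besov_ball_sym P beta)
  (@besov_ball_triangle P beta) erefl.

(* [u] is the distribution given by the function [h]. *)
Definition represents (h : R * R -> R) (u : distr R) : Prop :=
  forall phi : test R, u phi = \int[torus R]_x (h x * phi x).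

(* g = K f, for a zero-mean f; a distribution is determined by its Fourier
   coefficients. *)
Definition inverse_laplacian f g : Prop := forall k, fourier g k =
  if k == 0 then 0
  else ((k.1%:~R ^+ 2 + k.2%:~R ^+ 2)^-1)%:C * fourier f k.

(* w is the resonating term of f and g: the square partial sums of the double
   series converge to w in the sense of distributions. *)
Definition resonating P f g w : Prop := forall phi : test R,
  \int[torus R]_x ((\sum_(i < n) \sum_(j < n | (`|i - j| <= 1)%N)
      lp_block P i f x * lp_block P j g x) * phi x) @[n --> \oo] --> w phi.

(* (u, w) = (h, h o Kh) *)
Definition enhanced P (h : R * R -> R) (u w : distr R) : Prop :=
  represents h u /\ exists2 g, inverse_laplacian u g & resonating P u g w.

Definition zero_mean (h : R * R -> R) : Prop := \int[torus R]_x h x = 0.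

Definition L2_zero_mean : set (R * R -> R) :=
  [set h | (h : measurableTypeR R * measurableTypeR R -> R) \in Lfun (torus R) 2%:E
           /\ zero_mean h].

Definition pair_space P (alpha : R) : Type :=
  (besov P (alpha - 2) * besov P (2 * alpha - 2))%type.

Definition smooth_pairs P alpha : set (pair_space P alpha) :=
  [set p | exists (theta : test R) (c : R) (w : distr R),
     [/\ zero_mean theta, enhanced P theta (besov_distr p.1) w &
         forall phi, besov_distr p.2 phi = w phi - \int[torus R]_x (c * phi x)]].

Definition L2_pairs P alpha : set (pair_space P alpha) :=
  [set p | exists2 h, L2_zero_mean h &
     enhanced P h (besov_distr p.1) (besov_distr p.2)].

End Besov.

Arguments smooth_pairs {R} P alpha.
Arguments L2_pairs {R} P alpha.

(* Main.v *)
(* A square-integrable [h] has square-summable Fourier coefficients, and in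
   [h o Kh] only pairs of modes of comparable size interact, so that the double
   series of its coefficients converges absolutely by Schur's test with the
   kernel |l|^-2.  Hence [h |-> (h, h o Kh)] is well defined, and truncating the
   Fourier series of [h] approximates this pair by pairs of trigonometric
   polynomials.  The inclusion is strict because the mean of [h o Kh] is a sum
   of squares, while the second component of a smooth pair may be shifted by an
   arbitrary constant: (0, -1) stays at distance at least 1 from all
   (h, h o Kh). *)
Require Import Defs.
From HB Require Import structures.
From mathcomp Require Import all_boot all_order all_algebra.
From mathcomp Require Import complex finmap.
From mathcomp Require Import all_classical all_reals all_analysis measurable_realfun ess_sup_inf.
From mathcomp Require Import ring lra zify.
Set Implicit Arguments.
Unset Strict Implicit.
Unset Printing Implicit Defensive.
Import Order.TTheory GRing.Theory Num.Theory.
Import numFieldNormedType.Exports.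
Local Open Scope classical_set_scope.
Local Open Scope ring_scope.

(** * Integration on the torus *)

Section TorusIntegral.
Variable R : realType.
Local Notation mR2 := (measurableTypeR R * measurableTypeR R)%type.
Local Notation sq := (@square R).

(** Both Besov norms involve sup norms of blocks, whereas only the square-summability of the Fourier
    coefficients of [h] is available. For the first component the sup norm of block [n] may grow
    like 2^n, and the index alpha - 2 < -1 absorbs this growth. For the second one, absolute
    convergence of the double series makes the partial sums of [h o Kh] uniformly Cauchy and bounds
    the blocks uniformly in [n], which fits the negative index 2 alpha - 2. A single estimate, for
    an arbitrary weight on pairs of frequencies, serves for the existence of the resonating term
    (weight: difference of two partial sums), for its norm (weight: one partial sum) and for
    truncation (weight: pairs lost by cutting). Smallness always has the same source: the weight
    vanishes unless both nonzero frequencies are at least [r], so that only a tail of the sum of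
    squares enters. As test functions are real, cosines and sines replace e_k, and a product of two
    modes carries the frequencies k + l and k - l. *)

Lemma open_measurable2 (U : set (R * R)) : open U -> measurable (U : set mR2).
Proof.
(* The product sigma-algebra is generated by rectangles, so the open set is exhausted by countably
   many boxes with rational centre and radius 1/(n+1). *)
move=> oU; pose B (p : rat * rat * nat) : set mR2 :=
  [set x | `|ratr p.1.1 - x.1| < p.2.+1%:R^-1 /\ `|ratr p.1.2 - x.2| < p.2.+1%:R^-1].
have mB p : measurable (B p).
  have m1 (q : R) (e : R) : measurable [set x : measurableTypeR R | `|q - x| < e].
    rewrite (_ : [set _ | _] = ball q e); first exact: measurable_ball.
    by apply/seteqP; split => x; rewrite -ball_normE.
  rewrite (_ : B p = [set x : measurableTypeR R | `|ratr p.1.1 - x| < p.2.+1%:R^-1] `*`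
     [set x : measurableTypeR R | `|ratr p.1.2 - x| < p.2.+1%:R^-1]).
    by apply: measurableX.
  by apply/seteqP; split => x.
rewrite (_ : U = \bigcup_(p in [set p | B p `<=` U]) B p).
  rewrite bigcup_mkcond; apply: countable_bigcupT_measurable => // p.
  by case: ifP.
apply/seteqP; split => [x Ux|x [p pU /pU]//].
have /nbhs_ballP[e /= e0 he] : nbhs x U by rewrite nbhsE; exists U.
have [n] : exists n : nat, n.+1%:R^-1 < e / 2.
  have /ltr_add_invr[k hk] : 0 < e / 2 by rewrite divr_gt0.
  by exists k; rewrite add0r in hk.
have n0 : (0 : R) < n.+1%:R^-1 by rewrite invr_gt0.
have BE p q : B (p, q, n) =  [set x | `|ratr p - x.1| < n.+1%:R^-1 /\ `|ratr q - x.2| < n.+1%:R^-1] by [].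
move: n0 BE; move: (n.+1%:R^-1) => a n0 BE hn.
have near_rat (t : R) : exists q : rat, `|ratr q - t| < a.
  have /rat_in_itvoo[q] : t - a < t + a by lra.
  by rewrite in_itv/= => /andP[h1 h2]; exists q; rewrite ltr_distl; apply/andP; split; lra.
have [q1 h1] := near_rat x.1; have [q2 h2] := near_rat x.2.
exists (q1, q2, n); last by rewrite BE.
rewrite /= BE => y [/= h3 h4]; apply: he; split => /=.
  rewrite -ball_normE/=; apply: (le_lt_trans (ler_distD (ratr q1) _ _)).
  rewrite [in X in X + _]distrC; lra.
rewrite -ball_normE/=; apply: (le_lt_trans (ler_distD (ratr q2) _ _)).
by rewrite [in X in X + _]distrC; lra.
Qed.

Lemma continuous_measurable2 (f : R * R -> R) :
  continuous f -> measurable_fun [set: mR2] (f : mR2 -> measurableTypeR R).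
Proof.
move=> cf; apply: (measurability _ (RGenOInfty.measurableE R)) => //.
move=> _ [_ [a ->] <-]; rewrite setTI; apply: open_measurable2.
by move/continuousP : cf; apply; exact: interval_open.
Qed.

Lemma torus_setT : torus R setT = ((pi *+ 2) ^+ 2)%:E.
Proof.
have p0 : (0 : R) < pi *+ 2 by rewrite mulrn_wgt0// pi_gt0.
rewrite /torus/= /mrestr setTI /square product_measure1E//=.
by rewrite lebesgue_measure_itv/= lte_fin p0 -EFinB -EFinM subr0 expr2.
Qed.

Lemma torus_fin : (torus R setT < +oo)%E.
Proof. by rewrite torus_setT ltry. Qed.

Lemma torus_squareC : torus R (~` (sq : set mR2)) = 0%E.
Proof. by rewrite /torus/= /mrestr setICl measure0. Qed.

Lemma squareDC : [set: mR2] `\` ~` (sq : set mR2) = sq.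
Proof. by rewrite setDE setCK setTI. Qed.

(** The complement of the square is negligible for [torus]. Passing to the product of Lebesgue
    measures makes Fubini applicable. *)
Lemma torus_integral (f : mR2 -> \bar R) : measurable_fun setT f ->
  (torus R).-integrable setT f ->
  (\int[torus R]_x f x = \int[lebesgue_measure \x lebesgue_measure]_(x in sq) f x)%E.
Proof.
move=> mf fi; have mS : measurable (~` (sq : set mR2)).
  by apply: measurableC; exact: measurable_square.
transitivity (\int[torus R]_(x in setT `\` ~` (sq : set mR2)) f x)%E.
  exact: (negligible_integral mS measurableT fi torus_squareC).
rewrite squareDC; apply: eq_measure_integral => A mA sA.
by rewrite /torus/= /mrestr setIidl.
Qed.

Lemma integrable_square (mu : {measure set mR2 -> \bar R}) (f : R * R -> R) :
  (mu sq < +oo)%E -> continuous f -> mu.-integrable sq (EFin \o f : mR2 -> \bar R).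
Proof.
move=> muS cf; apply: measurable_bounded_integrable => //.
- exact: measurable_square.
- exact: measurable_funS (continuous_measurable2 cf).
- have cS : compact sq by apply: compact_setX; exact: segment_compact.
  have /compact_bounded : compact (f @` sq).
    by apply: continuous_compact => //; exact: continuous_subspaceT.
  move=> [M [Mr h]]; exists M; split => // N MN x Sx /=.
  by apply: (h N MN); exists x.
Qed.

Lemma continuous_integrable (f : R * R -> R) : continuous f ->
  (torus R).-integrable setT (EFin \o f : mR2 -> \bar R).
Proof.
move=> cf; have mf := continuous_measurable2 cf.
have mS : measurable (~` (sq : set mR2)).
  by apply: measurableC; exact: measurable_square.
apply/(negligible_integrable mS) => //; first exact/measurable_EFinP.
  exact: torus_squareC.
rewrite squareDC; apply: integrable_square => //.
by rewrite (le_lt_trans _ torus_fin)// le_measure ?inE//; exact: measurable_square.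
Qed.

End TorusIntegral.

(** * Integrals of trigonometric functions *)

Section TrigIntegral.
Variable R : realType.
Local Notation mR2 := (measurableTypeR R * measurableTypeR R)%type.
Local Notation sq := (@square R).
Local Notation leb := (@lebesgue_measure R).
Implicit Types k l q : int * int.

Lemma is_derive_pslice_trig k (a b : R) d (x : R * R) (t : R) :
  is_derive t 1 (pslice d (trig k a b) x)
    (pslice d (trig k (b * (if d then k.2 else k.1)%:~R)
                      (- a * (if d then k.2 else k.1)%:~R)) x t).
Proof.
case: d; first exact: (is_derive_trig k a b true (x.1, t)).
exact: (is_derive_trig k a b false (t, x.2)).
Qed.

(** A primitive is again of the form [trig k], with coefficients divided by the frequency; being
    periodic, it takes equal values at both ends. *)
Lemma trig_slice_int k (a b : R) d (x : R * R) : (if d then k.2 else k.1) != 0 ->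
  (\int[leb]_(t in `[0%R, (pi *+ 2)%R]) (pslice d (trig k a b) x t)%:E = 0)%E.
Proof.
set m : int := if d then k.2 else k.1 => m0.
have mR0 : m%:~R != 0 :> R by rewrite intr_eq0.
have p0 : (0 : R) < pi *+ 2 by rewrite mulrn_wgt0// pi_gt0.
pose pt t := if d then (x.1, t) else (t, x.2).
pose F := pslice d (trig k (- b / m%:~R) (a / m%:~R)) x.
have dF (t : R) : is_derive t 1 F (pslice d (trig k a b) x t).
  have := is_derive_pslice_trig k (- b / m%:~R) (a / m%:~R) d x t.
  rewrite -/m -/F divfK//.
  by have -> : - (- b / m%:~R) * m%:~R = b by field.
have cF : continuous F.
  move=> t; apply: differentiable_continuous; apply/derivable1_diffP.
  by have [] := dF t.
rewrite (@continuous_FTC2 _ _ F)//.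
- have -> : F (pi *+ 2) = F 0; last by rewrite subee.
  have := test_trig k (- b / m%:~R) (a / m%:~R); rewrite inE => -[_ [p1 p2]].
  rewrite /F /pslice; case: (d).
    by rewrite -(p2 (x.1, 0))/=; congr (trig _ _ _ (_, _)); rewrite /= ?addr0 ?add0r.
  by rewrite -(p1 (0, x.2))/=; congr (trig _ _ _ (_, _)); rewrite /= ?addr0 ?add0r.
- apply: continuous_subspaceT => t.
  have -> : pslice d (trig k a b) x = trig k a b \o pt.
    by apply/funext => u; rewrite /pslice /pt/=; case: (d).
  apply: continuous_comp; last exact: continuous_trig.
  rewrite /pt; case: (d).
    exact: (@cvg_pair _ _ _ (nbhs t) _ _ _ _ _ (fun=> x.1) id (cvg_cst _) cvg_id).
  exact: (@cvg_pair _ _ _ (nbhs t) _ _ _ _ _ id (fun=> x.2) cvg_id (cvg_cst _)).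
- split; first by move=> t _; have [] := dF t.
    by apply: cvg_at_right_filter; exact: cF.
  by apply: cvg_at_left_filter; exact: cF.
- by move=> t _; rewrite derive1E; have := dF t => ?; rewrite derive_val.
Qed.

Lemma continuous_integrable_square (f : R * R -> R) : continuous f ->
  (leb \x leb)%E.-integrable setT (((EFin \o f) \_ sq) : mR2 -> \bar R).
Proof.
move=> cf; have mf := continuous_measurable2 cf.
have mS : measurable (sq : set mR2) by exact: measurable_square.
rewrite -integrable_mkcond//; apply: integrable_square => //.
by have := torus_fin R; rewrite /torus/= /mrestr setTI.
Qed.

Lemma int_trig k (a b : R) : \int[torus R]_x trig k a b x =
  if k == 0 then (pi *+ 2) ^+ 2 * a else 0.
Proof.
case: eqP => [->|/eqP k0].
  have -> : trig 0 a b = cst a.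
    by apply/funext => x; rewrite /trig /angle/= !mul0r addr0 cos0 sin0 mulr0 mulr1 addr0.
  by rewrite (Rintegral_cst _ measurableT) torus_setT/= mulrC.
have cT := @continuous_trig R k a b.
have iT := continuous_integrable cT.
rewrite /Rintegral torus_integral//; last by exact: measurable_int iT.
rewrite integral_mkcond.
have iS := continuous_integrable_square cT.
(* Fubini is used in the order whose inner integral runs over a coordinate with nonzero
   frequency. *)
have [k20|k20] := eqVneq k.2 0; last first.
  rewrite -integral12_prod_meas1// integral0_eq// => x _.
  rewrite /fubini_F; have [xI|xI] := boolP (x \in `[0%R, (pi *+ 2)%R]%classic).
    rewrite -[RHS](@trig_slice_int k a b true (x, 0))// [RHS]integral_mkcond.
    apply: eq_integral => y _; rewrite /patch; congr (if _ then _ else _).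
    by rewrite /square in_setX xI.
  apply: integral0_eq => y _; rewrite /patch ifF// /square in_setX.
  by apply/negbTE; rewrite negb_and xI.
have k10 : k.1 != 0.
  by apply: contraNneq k0 => k10; rewrite [k]surjective_pairing k10 k20.
rewrite -integral21_prod_meas1// integral0_eq// => y _.
rewrite /fubini_G; have [yI|yI] := boolP (y \in `[0%R, (pi *+ 2)%R]%classic).
  rewrite -[RHS](@trig_slice_int k a b false (0, y))// [RHS]integral_mkcond.
  apply: eq_integral => x _; rewrite /patch; congr (if _ then _ else _).
  by rewrite /square in_setX yI andbT.
apply: integral0_eq => x _; rewrite /patch ifF// /square in_setX.
by apply/negbTE; rewrite negb_and yI orbT.
Qed.

Lemma trigM k l (a b c d : R) x : trig k a b x * trig l c d x =
  trig (k + l) ((a * c - b * d) / 2) ((a * d + b * c) / 2) x +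
  trig (k - l) ((a * c + b * d) / 2) ((b * c - a * d) / 2) x.
Proof.
have aD : angle (k + l) x = angle k x + angle l x.
  by rewrite /angle/= !intrD; ring.
have aB : angle (k - l) x = angle k x - angle l x.
  by rewrite /angle/= !intrB; ring.
by rewrite /trig aD aB cosD sinD cosB sinB; field.
Qed.

Lemma le_trig k (a b : R) x : `|trig k a b x| <= `|a| + `|b|.
Proof.
rewrite /trig (le_trans (ler_normD _ _))// lerD// normrM ler_piMr//.
  by rewrite ler_norml cos_geN1 cos_le1.
by rewrite ler_norml sin_geN1 sin_le1.
Qed.

End TrigIntegral.

(** * Linearity of the torus integral; square-integrable functions as distributions *)

Section TorusLinear.
Variable R : realType.
Local Notation mR2 := (measurableTypeR R * measurableTypeR R)%type.
Implicit Types (f g h : R * R -> R) (k l q : int * int).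

Definition intg f : Prop := (torus R).-integrable setT (EFin \o f : mR2 -> \bar R).

Lemma intg_cont f : continuous f -> intg f.
Proof. exact: continuous_integrable. Qed.

Lemma intgD f g : intg f -> intg g -> intg (fun x => f x + g x).
Proof.
move=> If Ig; rewrite /intg (_ : EFin \o _ = (EFin \o f) \+ (EFin \o g))%E//.
exact: (integrableD measurableT If Ig).
Qed.

Lemma intgZ a f : intg f -> intg (fun x => a * f x).
Proof.
move=> If; rewrite /intg (_ : EFin \o _ = (fun x => a%:E * (EFin \o f) x))%E//.
exact: (integrableZl measurableT a If).
Qed.

Lemma tintD f g : intg f -> intg g ->
  \int[torus R]_x (f x + g x) = \int[torus R]_x f x + \int[torus R]_x g x.
Proof. by move=> If Ig; exact: (RintegralD measurableT If Ig). Qed.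

Lemma tintZ a f : intg f -> \int[torus R]_x (a * f x) = a * \int[torus R]_x f x.
Proof. by move=> If; exact: (RintegralZl a measurableT If). Qed.

Lemma intg0 : intg (fun=> 0).
Proof. by apply: intg_cont => x; exact: cvg_cst. Qed.

Lemma tint0 : \int[torus R]_x (0 : R) = 0.
Proof. by rewrite (Rintegral_cst _ measurableT) mul0r. Qed.

Lemma intg_sum I (s : seq I) (F : I -> R * R -> R) : (forall i, intg (F i)) ->
  intg (fun x => \sum_(i <- s) F i x).
Proof.
move=> IF; elim: s => [|i s IH].
  by rewrite (_ : (fun _ => _) = fun=> 0); [exact: intg0|apply/funext => x; rewrite big_nil].
rewrite (_ : (fun _ => _) = fun x => F i x + \sum_(j <- s) F j x); first exact: intgD.
by apply/funext => x; rewrite big_cons.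
Qed.

Lemma tint_sum I (s : seq I) (F : I -> R * R -> R) : (forall i, intg (F i)) ->
  \int[torus R]_x (\sum_(i <- s) F i x) = \sum_(i <- s) \int[torus R]_x F i x.
Proof.
move=> IF; elim: s => [|i s IH].
  by rewrite big_nil -[RHS]tint0; apply: eq_Rintegral => x _; rewrite big_nil.
rewrite big_cons -IH -tintD//; last exact: intg_sum.
by apply: eq_Rintegral => x _; rewrite big_cons.
Qed.

Lemma tint_ge0 f : (forall x, 0 <= f x) -> 0 <= \int[torus R]_x f x.
Proof. by move=> f0; apply: Rintegral_ge0. Qed.

Lemma cont_sum I (s : seq I) (F : I -> R * R -> R) : (forall i, continuous (F i)) ->
  continuous (fun x => \sum_(i <- s) F i x).
Proof.
move=> IF; elim: s => [|i s IH].
  rewrite (_ : (fun _ => _) = fun=> 0) => [x|]; first exact: cvg_cst.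
  by apply/funext => x; rewrite big_nil.
rewrite (_ : (fun _ => _) = fun x => F i x + \sum_(j <- s) F j x) => [x|].
  by apply: cvgD; [exact: IF|exact: IH].
by apply/funext => x; rewrite big_cons.
Qed.

Lemma contM f g : continuous f -> continuous g -> continuous (fun x => f x * g x).
Proof. by move=> cf cg x; apply: cvgM; [exact: cf|exact: cg]. Qed.

Lemma contZ (a : R) f : continuous f -> continuous (fun x => a * f x).
Proof. by move=> cf x; apply: cvgM; [exact: cvg_cst|exact: cf]. Qed.

Lemma continuous_Lfun2 f : continuous f ->
  (f : mR2 -> measurableTypeR R) \in Lfun (torus R) 2%:E.
Proof.
move=> cf; have mf := continuous_measurable2 cf.
rewrite inE; apply/andP; split; first by rewrite inE.
rewrite inE /= /finite_norm unlock.
have -> : (fun x => (`|(EFin \o f) x| `^ 2)%E) = EFin \o (fun x => f x * f x).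
  apply/funext => x; rewrite [LHS]/= powR_mulrn//.
  by rewrite -normrX ger0_norm ?sqr_ge0// expr2.
have /integrableP[_] := intg_cont (contM cf cf).
rewrite (_ : (fun x => _) = EFin \o (fun x => f x * f x)); last first.
  by apply/funext => x /=; rewrite ger0_norm// -expr2 sqr_ge0.
by move=> h; rewrite poweR_lty.
Qed.

Definition isL2 h : Prop := (h : mR2 -> measurableTypeR R) \in Lfun (torus R) 2%:E.

Lemma intg_L2M h f : isL2 h -> isL2 f -> intg (fun x => h x * f x).
Proof.
move=> hh cf.
by have /Lfun1_integrable := Lfun2_mul_Lfun1 hh cf.
Qed.

Lemma intg_L2 h : isL2 h -> intg h.
Proof.
move=> hh; have /Lfun1_integrable// : (h : mR2 -> measurableTypeR R) \in Lfun (torus R) 1.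
by apply: Lfun_subset12 hh; rewrite torus_setT.
Qed.

Lemma continuous_test (phi : test R) : continuous phi.
Proof.
case: phi => phi /= hp; move: (hp); rewrite inE => -[sp _].
by have [] := sp [::].
Qed.

Lemma testE (a : R) (f g : test R) x : (a *: f + g : test R) x = a * f x + g x.
Proof. by []. Qed.

(** The distribution has order 0: the torus has finite measure, so [h] is in L^1, and its L^1 norm
    is the constant. *)
Lemma L2_distr h : isL2 h -> exists u : distr R, represents h u.
Proof.
move=> hh; pose u (phi : test R) := \int[torus R]_x (h x * phi x).
have Ih phi : intg (fun x => h x * (phi : test R) x).
  by apply: intg_L2M => //; apply: continuous_Lfun2; exact: continuous_test.
suff uP : u \in @distr_pred R by exists (Distr uP).
rewrite inE; split.
  move=> a f g; rewrite /u -[RHS]/(a * _ + _) -tintZ// -tintD//; last exact: intgZ.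
  by apply: eq_Rintegral => x _; rewrite testE; ring.
exists 0%N, (\int[torus R]_x `|h x|) => phi M hM.
have Ia : intg (fun x => `|h x|) by have /integrable_abse := intg_L2 hh.
apply: (le_trans (le_normr_Rintegral measurableT (Ih phi))).
rewrite mulrC -tintZ//; apply: (le_Rintegral measurableT) => //.
- by have /integrable_abse := Ih phi.
- exact: intgZ.
- by move=> x _; rewrite normrM mulrC ler_wpM2r//; exact: (hM [::]).
Qed.

End TorusLinear.

(** * Sums over boxes of frequencies *)

Section Boxes.
Variable R : realType.
Implicit Types (k l q : int * int) (N M : nat).

(** The balls of the sup norm are the boxes, whose points are counted exactly. *)
Definition nrm k : nat := maxn `|k.1| `|k.2|.

Definition zrange N : seq int := [seq i%:Z - N%:Z | i <- iota 0 (2 * N).+1].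

Definition box N : seq (int * int) := [seq (i, j) | i <- zrange N, j <- zrange N].

Lemma mem_zrange N (z : int) : (z \in zrange N) = (`|z| <= N)%N.
Proof.
apply/mapP/idP => [[i + ->]|zN]; first by rewrite mem_iota; lia.
by exists (absz (z + N%:Z)%R); [rewrite mem_iota; lia|lia].
Qed.

Lemma zrange_uniq N : uniq (zrange N).
Proof. by rewrite map_inj_uniq ?iota_uniq// => i j; lia. Qed.

Lemma size_zrange N : size (zrange N) = (2 * N).+1.
Proof. by rewrite size_map size_iota. Qed.

Lemma mem_box N k : (k \in box N) = (nrm k <= N)%N.
Proof.
rewrite /nrm geq_max -!mem_zrange; case: k => i j.
apply/allpairsP/andP => [[p [ai bj [-> ->]]]//|[ai bj]].
by exists (i, j).
Qed.

Lemma box_uniq N : uniq (box N).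
Proof.
apply: allpairs_uniq; [exact: zrange_uniq|exact: zrange_uniq|].
by move=> [a b] [c d].
Qed.

Lemma size_box N : size (box N) = ((2 * N).+1 ^ 2)%N.
Proof. by rewrite size_allpairs size_zrange -mulnn. Qed.

Lemma nrmN k : nrm (- k) = nrm k.
Proof. by case: k => i j; rewrite /nrm/= !abszN. Qed.

Lemma nrm_eq0 k : (nrm k == 0)%N = (k == 0).
Proof. by case: k => i j; rewrite /nrm -leqn0 geq_max !leqn0 !absz_eq0. Qed.

Lemma nrm_gt0 k : k != 0 -> (0 < nrm k)%N.
Proof. by rewrite lt0n nrm_eq0. Qed.

Lemma perm_filter_subset (s t : seq (int * int)) :
  uniq s -> uniq t -> {subset s <= t} -> perm_eq s [seq k <- t | k \in s].
Proof.
move=> us ut st; apply: uniq_perm => //; first exact: filter_uniq.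
by move=> k; rewrite mem_filter; apply/idP/andP => [ks|[]//]; split; [|exact: st].
Qed.

Lemma le_sum_subset (s t : seq (int * int)) (F : int * int -> R) :
  uniq s -> uniq t -> {subset s <= t} -> (forall k, 0 <= F k) ->
  \sum_(k <- s) F k <= \sum_(k <- t) F k.
Proof.
move=> us ut st F0; rewrite (perm_big _ (perm_filter_subset us ut st)) big_filter.
by rewrite [leRHS](bigID (mem s))/= lerDl sumr_ge0.
Qed.

Lemma sum_subset (s t : seq (int * int)) (F : int * int -> R) :
  uniq s -> uniq t -> {subset s <= t} ->
  (forall k, k \in t -> k \notin s -> F k = 0) ->
  \sum_(k <- t) F k = \sum_(k <- s) F k.
Proof.
move=> us ut st F0; rewrite (perm_big _ (perm_filter_subset us ut st)) big_filter.
rewrite (bigID (mem s))/= [X in _ + X]big_seq_cond [X in _ + X]big1 ?addr0//.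
by move=> k /andP[]; exact: F0.
Qed.

Lemma box_subset N M : (N <= M)%N -> {subset box N <= box M}.
Proof. by move=> NM k; rewrite !mem_box => /leq_trans; apply. Qed.

Lemma le_sum_box N M (F : int * int -> R) : (N <= M)%N -> (forall k, 0 <= F k) ->
  \sum_(k <- box N) F k <= \sum_(k <- box M) F k.
Proof.
by move=> NM; apply: le_sum_subset (box_subset NM); exact: box_uniq.
Qed.

Lemma sum_box_widen N M (F : int * int -> R) : (N <= M)%N ->
  (forall k, (N < nrm k)%N -> F k = 0) ->
  \sum_(k <- box M) F k = \sum_(k <- box N) F k.
Proof.
move=> NM F0; apply: sum_subset (box_subset NM) _; try exact: box_uniq.
by move=> k _; rewrite mem_box -ltnNge => /F0.
Qed.

Lemma sum_box1 N q (F : int * int -> R) :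
  \sum_(k <- box N) (if k == q then F k else 0) = if (nrm q <= N)%N then F q else 0.
Proof.
rewrite -big_mkcond/=; case: ifPn => [qN|qN].
  by rewrite -big_filter filter_pred1_uniq ?mem_box ?box_uniq// big_seq1.
rewrite big_seq_cond big1// => k /andP[kN /eqP kq].
by move: kN; rewrite kq mem_box (negbTE qN).
Qed.

Lemma card_box_le (s : seq (int * int)) N : uniq s -> (forall k, k \in s -> (nrm k <= N)%N) ->
  (size s <= (2 * N).+1 ^ 2)%N.
Proof.
move=> us sN; rewrite -size_box; apply: uniq_leq_size => // k /sN.
by rewrite mem_box.
Qed.

(** The bound depends on the radius [M] of the region selected by [p], not on the truncation [N]. *)
Lemma sum_const_le N M (p : pred (int * int)) (c : R) : 0 <= c ->
  (forall k, p k -> (nrm k <= M)%N) ->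
  \sum_(k <- box N | p k) c <= ((2 * M).+1 ^ 2)%:R * c.
Proof.
move=> c0 pM; rewrite -big_filter big_const_seq count_predT iter_addr_0 -[leLHS]mulr_natl.
rewrite ler_wpM2r// ler_nat; apply: card_box_le; first exact/filter_uniq/box_uniq.
by move=> k; rewrite mem_filter => /andP[/pM].
Qed.

End Boxes.

(** * Littlewood-Paley multipliers *)

Section Multipliers.
Variables (R : realType) (P : dyadic_partition R).
Implicit Types (k l q : int * int) (n N : nat).
Local Notation m := (lp_mult P).

Lemma lp_mult_ge0 n k : 0 <= m n k.
Proof. by case: n => [|n] /=; [exact: chi_ge0|exact: rho_ge0]. Qed.

(** Since [rho] is nonnegative, the partial sums increase to their limit 1. *)
Lemma sum_lp_mult N k : \sum_(i < N) m i k <= 1.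
Proof.
set x : R * R := (k.1%:~R, k.2%:~R).
have H := chi_rho_sum P x.
pose S n := chi P x + \sum_(0 <= j < n) dilate j (rho P) x.
have Snd : nondecreasing_seq S.
  apply/nondecreasing_seqP => n; rewrite /S lerD2l big_nat_recr//= lerDl.
  exact: rho_ge0.
have Sle n : S n <= 1.
  have := nondecreasing_cvgn_le Snd (cvgP _ H) n.
  by have /cvg_lim -> := H.
case: N => [|N]; first by rewrite big_ord0.
by have := Sle N; rewrite /S big_mkord big_ord_recl.
Qed.

Lemma lp_mult_le1 n k : m n k <= 1.
Proof.
apply: le_trans (sum_lp_mult n.+1 k).
by rewrite big_ord_recr/= lerDr sumr_ge0// => i _; exact: lp_mult_ge0.
Qed.

Lemma enorm0 : enorm ((0, 0) : R * R) = 0.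
Proof. by rewrite /enorm/= expr0n/= addr0 sqrtr0. Qed.

(** The origin lies outside every dilated annulus, so [chi] alone carries the partition of unity
    there. *)
Lemma lp_mult00 : m 0 0 = 1.
Proof.
have r0 j : dilate j (rho P) (0, 0) = 0.
  rewrite /dilate/= !mul0r; have [a [b [/andP[a0 _] h]]] := rho_annulus P.
  have [//|nz] := eqVneq (rho P (0, 0)) 0.
  have /h/= : tsupp (rho P) (0, 0) by exact: subset_closure.
  by rewrite enorm0 leNgt a0.
have := chi_rho_sum P (0, 0).
have -> : (fun n => chi P (0, 0) + \sum_(0 <= j < n) dilate j (rho P) (0, 0)) =
    cst (chi P (0, 0)).
  by apply/funext => n; rewrite big1 ?addr0.
by move/cvg_lim => /(_ (@Rhausdorff R)); rewrite lim_cst.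
Qed.

Lemma le_enorm (k : int * int) : (nrm k)%:R <= enorm (k.1%:~R, k.2%:~R) :> R.
Proof.
have a0 (u v : R) : `|u| <= Num.sqrt (u ^+ 2 + v ^+ 2).
  by rewrite -sqrtr_sqr ler_sqrt ?lerDl ?addr_ge0 ?sqr_ge0.
have c (z : int) : `|z|%N%:R = `|z%:~R| :> R by rewrite -intr_norm -abszE.
rewrite /nrm /maxn /enorm/=; case: ifP => _; rewrite c; last exact: a0.
by rewrite addrC; exact: a0.
Qed.

Lemma enorm_le (k : int * int) : enorm (k.1%:~R, k.2%:~R) <= 2 * (nrm k)%:R :> R.
Proof.
have c (z : int) : `|z%:~R| = `|z|%N%:R :> R by rewrite -intr_norm -abszE.
have h (z : int) : (`|z| <= nrm k)%N -> (z%:~R : R) ^+ 2 <= (nrm k)%:R ^+ 2.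
  by move=> zk; rewrite -real_normK ?num_real// lerXn2r ?nnegrE// c ler_nat.
have := h k.1 (leq_maxl _ _); have := h k.2 (leq_maxr _ _) => h2 h1.
rewrite /enorm/= -[leRHS]ger0_norm// -sqrtr_sqr ler_sqrt ?sqr_ge0//.
by rewrite exprMn; have := sqr_ge0 ((nrm k)%:R : R); lra.
Qed.

(* Frequencies are measured by [nrm], so that one integer constant serves for
   the ball and for both sides of the annulus. *)
Lemma lp_mult_supp : exists kp : nat, (0 < kp)%N /\ forall n k, m n k != 0 ->
  (nrm k <= kp * 2 ^ n)%N /\ (k != 0 -> (2 ^ n <= kp * nrm k)%N).
Proof.
have [r hr] := chi_ball P; have [a [b [/andP[a0 ab] hb]]] := rho_annulus P.
have b0 : 0 < b by exact: lt_trans ab.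
(* Integer bounds for the radius of the ball, the outer radius and the inverse inner radius. In
   [4 / a] one factor 2 is the loss in [enorm_le], the other comes from block [j.+1] using the
   dilation by 2^j. *)
pose N1 := Num.bound `|r|; pose N2 := Num.bound b; pose N3 := Num.bound (4 / a).
have h1 : `|r| < N1%:R by exact: archi_boundP.
have h2 : b < N2%:R by apply: archi_boundP; exact: ltW.
have h3 : 4 / a < N3%:R by apply: archi_boundP; rewrite divr_ge0// ltW.
exists (N1 + N2 + N3).+1; split => // -[|j] k /= nz.
  have /hr/= kr : tsupp (chi P) (k.1%:~R, k.2%:~R) by exact: subset_closure.
  split; last by rewrite expn0 muln_gt0/= => /nrm_gt0.
  have : (nrm k)%:R < N1%:R :> R.
    by rewrite (le_lt_trans (le_enorm k))// (le_lt_trans kr)// (le_lt_trans (ler_norm r)).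
  by rewrite ltr_nat expn0; lia.
have /hb/= : tsupp (rho P) (k.1%:~R / 2 ^+ j, k.2%:~R / 2 ^+ j) by exact: subset_closure.
have p : 0 < 2 ^+ j :> R by rewrite exprn_gt0.
have -> : enorm (k.1%:~R / 2 ^+ j, k.2%:~R / 2 ^+ j) =
    enorm (k.1%:~R, k.2%:~R) / 2 ^+ j :> R.
  rewrite /enorm/= !exprMn -mulrDl sqrtrM ?addr_ge0 ?sqr_ge0// sqrtr_sqr.
  by rewrite ger0_norm// invr_ge0 ltW.
rewrite ler_pdivlMr// ler_pdivrMr// => /andP[h4 h5]; split.
  have : (nrm k)%:R < (N2 * 2 ^ j)%:R :> R.
    rewrite (le_lt_trans (le_enorm k))// (le_lt_trans h5)//.
    by rewrite natrM natrX ltr_pM2r.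
  rewrite ltr_nat expnS => /ltnW/leq_trans; apply.
  by rewrite mulnA leq_mul2r; lia.
move=> _; have : (2 ^ j.+1)%:R <= (N3 * nrm k)%:R :> R.
  rewrite natrM natrX exprS; apply: (@le_trans _ _ (4 / a * (nrm k)%:R)).
    have := enorm_le k; move: (enorm _) h4 => e h4 h6.
    rewrite mulrAC ler_pdivlMr//; lra.
  by rewrite ler_wpM2r// ltW.
by rewrite ler_nat => /leq_trans; apply; rewrite leq_mul2r; lia.
Qed.

End Multipliers.

(** * Fourier coefficients *)

Section Coefficients.
Variable R : realType.
Implicit Types (u g : distr R) (h : R * R -> R) (k l q : int * int) (N M : nat).

Definition tau : R := (pi *+ 2) ^+ 2.

Lemma tau_gt0 : 0 < tau.
Proof. by rewrite exprn_gt0// mulrn_wgt0// pi_gt0. Qed.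

(** [cosc] and [sinc] are the real part and minus the imaginary part of [fourier u k]. They are even
    and odd in [k], and the Fourier series of [u] is the sum of [trig k (cosc u k) (sinc u k)] over
    all [k]. *)
Definition cosc u k : R := tau^-1 * u (cos_test R k).
Definition sinc u k : R := tau^-1 * u (sin_test R k).

Definition trig_test k (a b : R) : test R := Test (test_trig k a b).

Lemma distr_lin u (a : R) (f g : test R) : u (a *: f + g) = a * u f + u g.
Proof. by case: u => u /= hu; move: (hu); rewrite inE => -[lu _]; exact: lu. Qed.

Lemma distr0 u : u 0 = 0.
Proof.
have := distr_lin u (-1) 0 0; rewrite scaler0 addr0.
lra.
Qed.

Lemma distr_trig u k a b : u (trig_test k a b) = tau * (a * cosc u k + b * sinc u k).
Proof.
have -> : trig_test k a b = a *: cos_test R k + (b *: sin_test R k + 0).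
  apply: val_inj; apply/funext => x; rewrite /= /trig.
  rewrite -[RHS]/(a * (1 * cos (angle k x) + 0 * sin (angle k x)) +
    (b * (0 * cos (angle k x) + 1 * sin (angle k x)) + 0)); ring.
rewrite !distr_lin distr0 addr0 /cosc /sinc mulrDr; have := tau_gt0 => /lt0r_neq0 t0.
by field.
Qed.

Lemma angleN k (x : R * R) : angle (- k) x = - angle k x.
Proof. by rewrite /angle/= !intrN; ring. Qed.

Lemma angle0 (x : R * R) : angle 0 x = 0.
Proof. by rewrite /angle /= !mul0r addr0. Qed.

Lemma coscN u k : cosc u (- k) = cosc u k.
Proof.
congr (_ * u _); apply: val_inj; apply/funext => x.
by rewrite /= /trig angleN cosN !mul0r.
Qed.

Lemma sincN u k : sinc u (- k) = - sinc u k.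
Proof.
rewrite /sinc.
have -> : sin_test R (- k) = (-1) *: sin_test R k + 0.
  apply: val_inj; apply/funext => x; rewrite /= /trig angleN sinN.
  rewrite -[RHS]/(-1 * (0 * cos (angle k x) + 1 * sin (angle k x)) + 0); ring.
by rewrite distr_lin distr0 addr0 mulN1r mulrN.
Qed.

Lemma sinc0 u : sinc u 0 = 0.
Proof. by have := sincN u 0; rewrite oppr0; lra. Qed.

Lemma cosc0 u h : represents h u -> zero_mean h -> cosc u 0 = 0.
Proof.
move=> hu hz; rewrite /cosc hu.
rewrite -[RHS](mulr0 tau^-1) -[X in _ = _ * X]hz; congr (_ * _).
apply: eq_Rintegral => x _.
by rewrite /= /trig angle0 cos0 sin0 !mulr1 mulr0 addr0 mulr1.
Qed.

Lemma coscB u v k : cosc (u - v) k = cosc u k - cosc v k.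
Proof. by rewrite /cosc -mulrBr. Qed.

Lemma sincB u v k : sinc (u - v) k = sinc u k - sinc v k.
Proof. by rewrite /sinc -mulrBr. Qed.

(** The Fourier multiplier of [K]. *)
Definition lam k : R := if k == 0 then 0 else (k.1%:~R ^+ 2 + k.2%:~R ^+ 2)^-1.

Lemma lamN k : lam (- k) = lam k.
Proof. by rewrite /lam oppr_eq0/= !intrN !sqrrN. Qed.

Lemma lam_ge0 k : 0 <= lam k.
Proof. by rewrite /lam; case: ifP => // _; rewrite invr_ge0 addr_ge0 ?sqr_ge0. Qed.

Lemma nrm_sqr_le k : (nrm k)%:R ^+ 2 <= k.1%:~R ^+ 2 + k.2%:~R ^+ 2 :> R.
Proof.
have c (z : int) : `|z|%N%:R ^+ 2 = z%:~R ^+ 2 :> R.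
  by rewrite -[RHS]real_normK ?num_real// -intr_norm -abszE.
by rewrite /nrm /maxn; case: ifP => _; rewrite c ?lerDl ?lerDr sqr_ge0.
Qed.

Lemma lam_le k : lam k <= (nrm k)%:R ^- 2.
Proof.
rewrite /lam; case: ifPn => [_|k0]; first by rewrite invr_ge0 sqr_ge0.
have p : 0 < (nrm k)%:R ^+ 2 :> R by rewrite exprn_gt0// ltr0n nrm_gt0.
by rewrite lef_pV2 ?posrE ?nrm_sqr_le// (lt_le_trans p)// nrm_sqr_le.
Qed.

Lemma inverse_laplacianP u g : inverse_laplacian u g <->
  forall k, cosc g k = lam k * cosc u k /\ sinc g k = lam k * sinc u k.
Proof.
split=> H k; last first.
  have [Hc Hs] := H k; move: Hc Hs; rewrite /fourier /cosc /sinc /lam -/tau.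
  case: ifP => _ Hc Hs.
    by simpc; rewrite Hc Hs !mul0r oppr0.
  by simpc; rewrite Hc Hs.
have := H k; rewrite /fourier /cosc /sinc /lam -/tau; case: ifP => _; simpc.
  by move=> [-> /eqP]; rewrite oppr_eq0 => /eqP ->; rewrite ?mul0r.
by move=> [-> /eqP]; rewrite eqr_opp => /eqP ->.
Qed.

(** The two brackets are the zero modes of the product formula [trigM]; both are present when k = l
    = 0. *)
Lemma int_trigM k l (a b c d : R) :
  \int[torus R]_x (trig k a b x * trig l c d x) =
  tau / 2 * ((if k + l == 0 then a * c - b * d else 0) +
             (if k - l == 0 then a * c + b * d else 0)).
Proof.
under eq_Rintegral do rewrite trigM.
rewrite tintD; try by apply: intg_cont; exact: continuous_trig.
by rewrite !int_trig -/tau; do 2 case: ifP => _; field.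
Qed.

Lemma le_int_trigM k l (a b c d : R) :
  `|\int[torus R]_x (trig k a b x * trig l c d x)| <=
  tau * ((`|a| + `|b|) * (`|c| + `|d|)) / 2 *
    ((if k == - l then 1 else 0) + (if k == l then 1 else 0)).
Proof.
have ab : `|a * c| <= `|a| * `|c| by rewrite normrM.
have E : `|a * c| + `|b * d| <= (`|a| + `|b|) * (`|c| + `|d|).
  have := mulr_ge0 (normr_ge0 a) (normr_ge0 d).
  have := mulr_ge0 (normr_ge0 b) (normr_ge0 c).
  by rewrite !normrM; lra.
have E1 : `|a * c - b * d| <= (`|a| + `|b|) * (`|c| + `|d|).
  by apply: le_trans E; exact: ler_normB.
have E2 : `|a * c + b * d| <= (`|a| + `|b|) * (`|c| + `|d|).
  by apply: le_trans E; exact: ler_normD.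
have t0 := tau_gt0.
rewrite int_trigM addr_eq0 subr_eq0 normrM gtr0_norm ?divr_gt0//.
rewrite (_ : tau * _ / 2 = tau / 2 * ((`|a| + `|b|) * (`|c| + `|d|))); last by field.
rewrite -mulrA ler_pM2l ?divr_gt0// mulrDr.
rewrite (le_trans (ler_normD _ _))// lerD//; case: ifP; rewrite ?mulr1 ?mulr0 ?normr0//.
Qed.

(** With [a] even and [b] odd, the frequencies q and -q contribute equally, which cancels the factor
    1/2 of [int_trigM]; this covers q = 0 as well. *)
Lemma int_box_trigM N q (a b : int * int -> R) (c d : R) :
  (forall k, a (- k) = a k) -> (forall k, b (- k) = - b k) ->
  \int[torus R]_x (\sum_(k <- box N) trig k (a k) (b k) x * trig q c d x) =
  if (nrm q <= N)%N then tau * (a q * c + b q * d) else 0.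
Proof.
move=> aN bN; rewrite tint_sum; last first.
  by move=> k; apply: intg_cont; apply: contM; exact: continuous_trig.
under eq_bigr do rewrite int_trigM.
rewrite -mulr_sumr big_split/=.
have -> : \sum_(k <- box N) (if k + q == 0 then a k * c - b k * d else 0) =
  \sum_(k <- box N) (if k == - q then a k * c - b k * d else 0).
  by apply: eq_bigr => k _; rewrite addr_eq0.
have -> : \sum_(k <- box N) (if k - q == 0 then a k * c + b k * d else 0) =
  \sum_(k <- box N) (if k == q then a k * c + b k * d else 0).
  by apply: eq_bigr => k _; rewrite subr_eq0.
by rewrite !sum_box1 nrmN aN bN; case: ifP => _; field.
Qed.

(** Expand the integral of (h - S)^2 >= 0 for the Fourier partial sum S: the integrals of h S and of
    S^2 are both [tau * Q]. *)
Lemma bessel h u : isL2 h -> represents h u ->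
  exists B, forall N, \sum_(k <- box N) (cosc u k ^+ 2 + sinc u k ^+ 2) <= B.
Proof.
move=> hh hu; exists (tau^-1 * \int[torus R]_x (h x * h x)) => N.
set Q := \sum_(k <- _) _.
pose S (x : R * R) := \sum_(k <- box N) trig k (cosc u k) (sinc u k) x.
have cS : continuous S by apply: cont_sum => k; exact: continuous_trig.
have hS : \int[torus R]_x (h x * S x) = tau * Q.
  under eq_Rintegral do rewrite /S mulr_sumr.
  rewrite tint_sum; last first.
    by move=> k; apply: intg_L2M => //; apply/continuous_Lfun2/continuous_trig.
  rewrite /Q mulr_sumr; apply: eq_bigr => k _.
  by rewrite -(hu (trig_test k (cosc u k) (sinc u k))) distr_trig !expr2.
have SS : \int[torus R]_x (S x * S x) = tau * Q.
  under eq_Rintegral do rewrite {2}/S mulr_sumr.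
  rewrite tint_sum; last first.
    by move=> k; apply/intg_cont/contM => //; exact: continuous_trig.
  rewrite /Q mulr_sumr [LHS]big_seq [RHS]big_seq; apply: eq_bigr => k kN.
  under eq_Rintegral do rewrite /S mulr_suml.
  rewrite int_box_trigM; [|exact: coscN|exact: sincN].
  by rewrite -mem_box kN !expr2.
have S2 : isL2 S by exact: continuous_Lfun2.
have : 0 <= \int[torus R]_x ((h x * h x + (-2) * (h x * S x)) + S x * S x).
  apply: tint_ge0 => x; rewrite (_ : _ + _ = (h x - S x) ^+ 2) ?sqr_ge0//.
  by ring.
have I1 := intg_L2M hh hh; have I2 := intg_L2M hh S2; have I3 := intg_L2M S2 S2.
rewrite tintD//; last by apply: intgD => //; exact: intgZ.
rewrite tintD//; last exact: intgZ.
rewrite tintZ// hS SS => H; rewrite ler_pdivlMl ?tau_gt0//.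
lra.
Qed.

End Coefficients.

(** * The near-diagonal estimate *)

Section Estimates.
Variable R : realType.
Implicit Types (H : int * int -> R) (k l q : int * int) (N M r c : nat).
Implicit Types (om : int * int -> int * int -> R).
Local Notation lam := (@lam R).

(** Abstracts what the estimate uses of a weight: [c] measures how comparable the two frequencies
    are, and [r] is a lower cutoff that produces smallness. Zero frequencies are exempt, as their
    terms vanish by [H 0 = 0]. *)
Definition near_diag c r om : Prop := (forall k l, `|om k l| <= 1) /\
  forall k l, k != 0 -> l != 0 -> om k l != 0 ->
    [/\ (nrm k <= c * nrm l)%N, (nrm l <= c * nrm k)%N,
        (r <= nrm k)%N & (r <= nrm l)%N].

Definition diag_sum om H N : R :=
  \sum_(k <- box N) \sum_(l <- box N) `|om k l| * (lam l * (H k * H l)).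

(** At most (2cn+1)^2 frequencies of weight d/n^2 each: the total is bounded independently of n. *)
Lemma count_ratio c n (d : R) : (0 < n)%N -> 0 <= d ->
  ((2 * (c * n)).+1 ^ 2)%:R * (d * n%:R ^- 2) <= d * ((2 * c).+1 ^ 2)%:R :> R.
Proof.
move=> n0 d0; have p : 0 < n%:R ^+ 2 :> R by rewrite exprn_gt0// ltr0n.
rewrite mulrCA ler_wpM2l// ler_pdivrMr// -natrX -natrM ler_nat -expnMn leq_sqr; nia.
Qed.

(** Along a row [lam l] varies; comparability trades it for c^2 |k|^-2, and the admissible l lie in
    the box of radius c |k|. *)
Lemma near_diag_row c r om k N : near_diag c r om -> k != 0 ->
  \sum_(l <- box N | (l != 0) && (om k l != 0)) lam l <=
  (c ^ 2)%:R * ((2 * c).+1 ^ 2)%:R.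
Proof.
move=> [_ nd] k0; have nk := nrm_gt0 k0.
apply: le_trans (count_ratio c nk (ler0n _ _)).
have pk : 0 < (nrm k)%:R ^+ 2 :> R by rewrite exprn_gt0// ltr0n.
apply: (@le_trans _ _ (\sum_(l <- box N | (l != 0) && (om k l != 0))
    ((c ^ 2)%:R * (nrm k)%:R ^- 2))).
  apply: ler_sum => l /andP[l0 /(nd _ _ k0 l0)[h _ _ _]].
  have pl : 0 < (nrm l)%:R ^+ 2 :> R by rewrite exprn_gt0// ltr0n nrm_gt0.
  apply: (le_trans (lam_le _ _)); rewrite ler_pdivlMr// mulrC ler_pdivrMr//.
  by rewrite -!natrX -natrM ler_nat -expnMn leq_sqr.
apply: sum_const_le => [|l /andP[l0 /(nd _ _ k0 l0)[]//]].
by rewrite mulr_ge0// invr_ge0 ltW.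
Qed.

Lemma near_diag_col c r om l N : near_diag c r om -> l != 0 ->
  \sum_(k <- box N | (k != 0) && (om k l != 0)) lam l <= ((2 * c).+1 ^ 2)%:R.
Proof.
move=> [_ nd] l0; have nl := nrm_gt0 l0.
have := count_ratio c nl ler01; rewrite !mul1r; apply: le_trans.
have pl : 0 < (nrm l)%:R ^+ 2 :> R by rewrite exprn_gt0// ltr0n.
apply: (@le_trans _ _ (\sum_(k <- box N | (k != 0) && (om k l != 0)) (nrm l)%:R ^- 2)).
  by apply: ler_sum => k _; exact: lam_le.
apply: sum_const_le => [|k /andP[k0 /(nd _ _ k0 l0)[]//]].
by rewrite invr_ge0 ltW.
Qed.

(** The sum of the row bound c^2 (2c+1)^2 and the column bound (2c+1)^2. *)
Definition diag_cst c : R := ((c ^ 2).+1 * (2 * c).+1 ^ 2)%:R.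

(* Schur test: on the near-diagonal the kernel [lam l] has bounded row and
   column sums, because there are O(n^2) frequencies of size comparable to n. *)
Lemma diag_sum_le c r om H N : near_diag c r om -> (forall k, 0 <= H k) -> H 0 = 0 ->
  diag_sum om H N <= diag_cst c * \sum_(k <- box N | (r <= nrm k)%N) H k ^+ 2.
Proof.
move=> nd H0 Hz; have [om1 nd2] := nd.
pose g k := if (r <= nrm k)%N then H k ^+ 2 else 0.
have g0 k : 0 <= g k by rewrite /g; case: ifP => // _; exact: sqr_ge0.
pose e k l : R := if [&& k != 0, l != 0 & om k l != 0] then lam l else 0.
have step : diag_sum om H N <=
    \sum_(k <- box N) \sum_(l <- box N) (e k l * g k + e k l * g l).
  apply: ler_sum => k _; apply: ler_sum => l _.
  rewrite /e; have [->|k0] /= := eqVneq k 0; first by rewrite Hz !mul0r !mulr0 addr0.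
  have [->|l0] /= := eqVneq l 0; first by rewrite Hz !mul0r !mulr0 addr0.
  have [->|o0] /= := eqVneq (om k l) 0; first by rewrite normr0 !mul0r addr0.
  have [_ _ rk rl] := nd2 _ _ k0 l0 o0; rewrite /g rk rl -mulrDr.
  (* Young's inequality separates a part summed along rows from one summed along columns. Both
     squares may carry the cutoff of [g], because a nonzero weight forces both frequencies to be at
     least [r]. *)
  have hh : H k * H l <= H k ^+ 2 + H l ^+ 2.
    by have := sqr_ge0 (H k - H l); have := mulr_ge0 (H0 k) (H0 l); lra.
  rewrite -[leRHS]mul1r; apply: ler_pM => //.
    by rewrite !mulr_ge0 ?lam_ge0.
  by rewrite ler_wpM2l ?lam_ge0.
apply: (le_trans step); rewrite [X in _ * X]big_mkcond -/g.
have -> : \sum_(k <- box N) \sum_(l <- box N) (e k l * g k + e k l * g l) =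
    \sum_(k <- box N) \sum_(l <- box N) e k l * g k +
    \sum_(k <- box N) \sum_(l <- box N) e k l * g l.
  by rewrite -big_split; apply: eq_bigr => k _; rewrite -big_split.
rewrite /diag_cst mulSn natrD natrM mulrDl addrC; apply: lerD.
  rewrite exchange_big/= mulr_sumr; apply: ler_sum => l _.
  rewrite -mulr_suml ler_wpM2r//.
  have [->|l0] := eqVneq l 0.
    by rewrite big1 ?ler0n// => k _; rewrite /e eqxx andbF.
  apply: le_trans (near_diag_col N nd l0); rewrite [leRHS]big_mkcond/=.
  by apply: ler_sum => k _; rewrite /e l0.
rewrite mulr_sumr; apply: ler_sum => k _.
rewrite -mulr_suml ler_wpM2r//.
have [->|k0] := eqVneq k 0.
  by rewrite big1 ?mulr_ge0 ?ler0n// => l _; rewrite /e eqxx.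
apply: le_trans (near_diag_row N nd k0); rewrite [leRHS]big_mkcond/=.
by apply: ler_sum => l _; rewrite /e k0.
Qed.

Lemma tail_small (F : int * int -> R) B : (forall k, 0 <= F k) ->
  (forall N, \sum_(k <- box N) F k <= B) ->
  forall e : R, 0 < e -> exists r, forall N, \sum_(k <- box N | (r <= nrm k)%N) F k <= e.
Proof.
move=> F0 FB e e0; pose S N := \sum_(k <- box N) F k.
have Snd : nondecreasing_seq S by move=> N M NM; exact: le_sum_box.
have cS : cvgn S by apply: nondecreasing_is_cvgn => //; exists B => _ [N _ <-]; exact: FB.
have [r hr] : exists r, limn S - e < S r.
  have /cvgrPdist_lt/(_ _ e0)[r _ h] := cS; exists r.
  have := h r (leqnn r); rewrite /= ltr_distl => /andP[]; lra.
(* The box of radius r contains |k| = r, so the tail starts at r + 1. Enlarging [N] to [maxn N r]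
   lets the box contain that of radius r. *)
exists r.+1 => N; have := nondecreasing_cvgn_le Snd cS (maxn N r) => hM.
have h1 : \sum_(k <- box N | (r < nrm k)%N) F k <=
    \sum_(k <- box (maxn N r) | (r < nrm k)%N) F k.
  rewrite big_mkcond [leRHS]big_mkcond; apply: le_sum_box; first exact: leq_maxl.
  by move=> k; case: ifP.
have h2 : S (maxn N r) = S r + \sum_(k <- box (maxn N r) | (r < nrm k)%N) F k.
  rewrite /S (bigID (fun k => (nrm k <= r)%N))/=; congr (_ + _); last first.
    by apply: eq_bigl => k; rewrite -ltnNge.
  rewrite big_mkcond (@sum_box_widen _ r (maxn N r)); last 2 first.
  - exact: leq_maxr.
  - by move=> k; rewrite ltnNge => /negbTE ->.
  rewrite big_seq [RHS]big_seq; apply: eq_bigr => k; rewrite mem_box => -> //.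
lra.
Qed.

Lemma sum_inv_sqr N : \sum_(0 <= i < N) (i.+1%:R ^- 2 : R) <= 2.
Proof.
(* The sharper bound 2 - 1/(N+1) is the one that passes through the induction. *)
suff : \sum_(0 <= i < N.+1) (i.+1%:R ^- 2 : R) <= 2 - N.+1%:R^-1.
  move=> h; apply: (@le_trans _ _ (\sum_(0 <= i < N.+1) (i.+1%:R ^- 2 : R))).
    by rewrite big_nat_recr//= lerDl invr_ge0 sqr_ge0.
  by apply: (le_trans h); rewrite lerBlDr lerDl invr_ge0.
elim: N => [|N IH]; first by rewrite big_nat1 expr1n invr1; lra.
rewrite big_nat_recr//=; apply: (le_trans (lerD IH (lexx _))).
have p1 : 0 < N.+1%:R :> R by rewrite ltr0n.
have p2 : 0 < N.+2%:R :> R by rewrite ltr0n.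
have e : N.+2%:R = N.+1%:R + 1 :> R by rewrite -natr1.
rewrite -subr_ge0 (_ : _ - _ = (N.+1%:R * N.+2%:R ^+ 2)^-1); last first.
  by rewrite e; field; apply/andP; split; apply: lt0r_neq0; lra.
by rewrite invr_ge0 mulr_ge0 ?sqr_ge0// ltW.
Qed.

(** 5 = 2 + 1 + 2, from the negative integers, zero and the positive integers. *)
Lemma sum_zrange N : \sum_(z <- zrange N) ((1 + z%:~R ^+ 2)^-1 : R) <= 5.
Proof.
rewrite big_map (_ : (2 * N).+1 = (N + N.+1)%N); last lia.
rewrite iotaD big_cat/= add0n.
have h i : ((1 + (i%:Z)%:~R ^+ 2)^-1 : R) <= if i is j.+1 then j.+1%:R ^- 2 else 1.
  case: i => [|j]; first by rewrite expr0n/= addr0 invr1.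
  by rewrite lef_pV2 ?posrE ?exprn_gt0 ?ltr0n ?addr_gt0 ?exprn_gt0 ?ltr0n// lerDr.
have h1 : \sum_(i <- iota 0 N) ((1 + (i%:Z - N%:Z)%:~R ^+ 2)^-1 : R) <= 2.
  apply: le_trans (sum_inv_sqr N); rewrite [leRHS]big_nat_rev/= add0n /index_iota subn0.
  rewrite big_seq [leRHS]big_seq; apply: ler_sum => i; rewrite mem_iota => /andP[_ iN].
  have -> : ((i%:Z - N%:Z)%:~R ^+ 2 : R) = ((N - i)%N%:Z)%:~R ^+ 2.
    by rewrite -sqrrN -intrN; congr (_%:~R ^+ 2); lia.
  have := h (N - i)%N; have -> : (N - i)%N = (N - i.+1).+1 by lia.
  by [].
have h2 : \sum_(i <- iota N N.+1) ((1 + (i%:Z - N%:Z)%:~R ^+ 2)^-1 : R) <= 3.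
  rewrite -[N in iota N]addn0 iotaDl big_map [iota _ _]/= big_cons.
  rewrite (iotaDl 1 0) big_map.
  have -> : 3 = 1 + 2 :> R by lra.
  apply: lerD; first by rewrite addn0 subrr expr0n/= addr0 invr1.
  apply: le_trans (sum_inv_sqr N); rewrite /index_iota subn0; apply: ler_sum => i _.
  have -> : ((N + (1 + i))%N%:Z - N%:Z) = i.+1%:Z by lia.
  exact: (h i.+1).
lra.
Qed.

(** For x, y >= 0 with x + y >= 1 one has (1 + x)(1 + y) <= 3 (x + y)^2, so the sum factorises over
    the coordinates; 75 = 3 * 5 * 5. This makes the Fourier series of Kh absolutely convergent. *)
Lemma sum_lam_sqr N : \sum_(k <- box N) lam k ^+ 2 <= 75.
Proof.
pose f (z : int) : R := (1 + z%:~R ^+ 2)^-1.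
have f0 z : 0 <= f z by rewrite invr_ge0 addr_ge0 ?sqr_ge0.
have h k : lam k ^+ 2 <= 3 * (f k.1 * f k.2).
  rewrite /lam; have [_|k0] := eqVneq k 0; first by rewrite expr0n/= !mulr_ge0.
  have p1 : 1 <= k.1%:~R ^+ 2 + k.2%:~R ^+ 2 :> R.
    apply: le_trans (nrm_sqr_le _ k).
    by rewrite -natrX (ler_nat _ 1) expn_gt0 nrm_gt0.
  rewrite /f; move: (sqr_ge0 (k.1%:~R : R)) (sqr_ge0 (k.2%:~R : R)) p1.
  move: (_ ^+ 2) (_ ^+ 2) => y x x0 y0 p1.
  have w0 : 0 < (1 + x) * (1 + y) by nra.
  have s0 : 0 < (x + y) ^+ 2 by nra.
  rewrite -invfM exprVn ler_pdivlMr// [leLHS]mulrC ler_pdivrMr//; nra.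
apply: (@le_trans _ _ (\sum_(k <- box N) 3 * (f k.1 * f k.2))).
  by apply: ler_sum => k _; exact: h.
rewrite -mulr_sumr /box big_allpairs.
under eq_bigr do rewrite /= -mulr_sumr.
rewrite -mulr_suml.
have := sum_zrange N; rewrite -/(f _) => s5.
have s0 : 0 <= \sum_(z <- zrange N) f z by apply: sumr_ge0.
have : (\sum_(z <- zrange N) f z) * (\sum_(z <- zrange N) f z) <= 5 * 5.
  by apply: ler_pM.
lra.
Qed.

End Estimates.

(** * Limits of distributions and blocks *)

Section Limits.
Variable R : realType.
Implicit Types (F : nat -> R * R -> R) (phi : test R).

(** The limit is taken after testing: against a fixed [phi] the integrals form a Cauchy sequence of
    reals, and linearity passes to the limit. *)
Lemma distr_lim F : (forall N, continuous (F N)) ->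
  (forall e : R, 0 < e -> exists M, forall N x, (M <= N)%N -> `|F N x - F M x| <= e) ->
  exists w : distr R, forall phi, \int[torus R]_x (F N x * phi x) @[N --> \oo] --> w phi.
Proof.
move=> cF Fc.
have IF N phi : intg (fun x => F N x * phi x).
  by apply/intg_cont/contM => //; exact: continuous_test.
have Ia (f : R * R -> R) : intg f -> intg (fun x => `|f x|) by move/integrable_abse.
have dist (e : R) M N phi : (forall x, `|F N x - F M x| <= e) ->
    `|\int[torus R]_x (F N x * phi x) - \int[torus R]_x (F M x * phi x)| <=
    e * \int[torus R]_x `|phi x|.
  move=> h; have IN := IF N phi; have IM := IF M phi.
  have -> : \int[torus R]_x (F N x * phi x) - \int[torus R]_x (F M x * phi x) =
      \int[torus R]_x (F N x * phi x + -1 * (F M x * phi x)).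
    by rewrite tintD ?tintZ ?mulN1r//; exact: intgZ.
  have ID := intgD IN (intgZ (-1) IM).
  have Ip : intg phi by apply/intg_cont/continuous_test.
  apply: (le_trans (le_normr_Rintegral measurableT ID)).
  rewrite -tintZ; last exact: Ia.
  apply: (le_Rintegral measurableT); [exact: Ia|exact/intgZ/Ia|].
  by move=> x _; rewrite mulN1r -mulrBl normrM ler_wpM2r.
have key phi (e : R) : 0 < e -> exists M, forall N, (M <= N)%N ->
    `|\int[torus R]_x (F N x * phi x) - \int[torus R]_x (F M x * phi x)| < e / 2.
  (* The summand 1 keeps [A] positive when [phi] is zero. *)
  move=> e0; pose A := \int[torus R]_x `|phi x| + 1.
  have A0 : 0 < A by rewrite ltr_wpDl//; exact: tint_ge0.
  have d0 : 0 < e / (3 * A) by rewrite divr_gt0 ?mulr_gt0.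
  have [M hM] := Fc _ d0; exists M => N MN.
  apply: (le_lt_trans (dist _ _ _ _ (fun x => hM N x MN))).
  rewrite (@le_lt_trans _ _ (e / (3 * A) * A))//.
    by rewrite (ler_wpM2l (ltW d0))// lerDl.
  have -> : e / (3 * A) * A = e / 3 by field; exact: lt0r_neq0.
  lra.
have cv phi : cvgn (fun N => \int[torus R]_x (F N x * phi x)).
  apply/cauchy_cvgP/cauchy_exP => e e0; have [M hd] := key phi e e0.
  exists (\int[torus R]_x (F M x * phi x)); exists M => // N /= /hd h.
  rewrite -ball_normE/= distrC (lt_trans h)//.
  by rewrite ltr_pdivrMr// ltr_pMr// ltr1n.
pose w phi := limn (fun N => \int[torus R]_x (F N x * phi x)).
suff wP : w \in @distr_pred R by exists (Distr wP) => phi; exact: cv.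
rewrite inE; split.
  move=> a f g; rewrite /w -[RHS]/(a * _ + _).
  apply/cvg_lim => //.
  have -> : (fun N => \int[torus R]_x (F N x * (a *: f + g : test R) x)) =
      (fun N => a * \int[torus R]_x (F N x * f x) + \int[torus R]_x (F N x * g x)).
    apply/funext => N; rewrite -tintZ// -tintD//; last exact: intgZ.
    by apply: eq_Rintegral => x _; rewrite testE; ring.
  by apply: cvgD; [apply: cvgM; [exact: cvg_cst|exact: cv]|exact: cv].
(* Tolerance 1 gives |F N| <= |F M| + 1 for all N >= M, hence a bound of order 0 for the limit. *)
have [M hM] := Fc 1 ltr01.
exists 0%N, (\int[torus R]_x (`|F M x| + 1)) => phi m hm.
have IFM : intg (fun x => `|F M x| + 1).
  apply: intgD; last by apply: intg_cont => x; exact: cvg_cst.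
  exact/Ia/intg_cont.
have bnd N : (M <= N)%N -> `|\int[torus R]_x (F N x * phi x)| <=
    \int[torus R]_x (`|F M x| + 1) * m.
  move=> MN; apply: (le_trans (le_normr_Rintegral measurableT (IF N phi))).
  rewrite mulrC -tintZ//.
  apply: (le_Rintegral measurableT); [exact/Ia/IF|exact: intgZ|].
  move=> x _; rewrite normrM mulrC; apply: ler_pM => //; first exact: (hm [::]).
  have := hM N x MN; have := ler_normD (F N x - F M x) (F M x).
  by rewrite subrK; lra.
rewrite ler_norml; apply/andP; split.
  apply: limr_ge; first exact: cv.
  by near=> N; have := bnd N; rewrite ler_norml => /(_ _)/andP[]//; near: N; exists M.
apply: limr_le; first exact: cv.
by near=> N; have := bnd N; rewrite ler_norml => /(_ _)/andP[]//; near: N; exists M.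
Unshelve. all: by end_near. Qed.

End Limits.

(** * Littlewood-Paley blocks as finite sums of modes *)

Section Blocks.
Variables (R : realType) (P : dyadic_partition R).
Implicit Types (u g w : distr R) (k l q : int * int) (n N : nat).
Local Notation m := (lp_mult P).
Local Notation lam := (@lam R).
Local Notation tau := (@tau R).

Definition in_box n N : Prop := forall k, m n k != 0 -> (nrm k <= N)%N.

Definition mode u k : R * R -> R := trig k (cosc u k) (sinc u k).

Lemma lp_block_box n N u x : in_box n N ->
  lp_block P n u x = \sum_(k <- box N) m n k * mode u k x.
Proof.
move=> nN; rewrite /lp_block (@fsbigTE _ _ _ _ [fset k in box N]%fset); last first.
  move=> k; rewrite in_fset /= mem_box => kN.
  have -> : m n k = 0 by apply: contraNeq kN => /nN.
  by rewrite !mul0r.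
rewrite raddf_sum (perm_big (box N)); last first.
  by apply: uniq_perm; [exact: fset_uniq|exact: box_uniq|move=> k; rewrite in_fset].
apply: eq_bigr => k _ /=.
by rewrite /fourier /mode /trig /cosc /sinc -/tau/=; ring.
Qed.

(* The block of [u] at [x] is [u] tested against the translated kernel. *)
Definition block_at n N (v : test R -> R) (x : R * R) : R :=
  \sum_(q <- box N) m n q * (tau^-1 * v (trig_test q (cos (angle q x)) (sin (angle q x)))).

Lemma lp_block_at n N u x : in_box n N -> lp_block P n u x = block_at n N u x.
Proof.
move=> nN; rewrite (lp_block_box _ _ nN); apply: eq_bigr => q _; congr (_ * _).
rewrite distr_trig mulKf ?lt0r_neq0 ?tau_gt0//.
by rewrite /mode /trig; ring.
Qed.

(** A block at a point involves finitely many test functions, so uniform bounds survive convergence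
    in the sense of distributions. *)
Lemma block_at_lim n N (v : nat -> test R -> R) w x E :
  (forall phi, v M phi @[M --> \oo] --> w phi) ->
  (forall M, `|block_at n N (v M) x| <= E) -> `|block_at n N w x| <= E.
Proof.
move=> vw vE.
have cv : block_at n N (v M) x @[M --> \oo] --> block_at n N w x.
  rewrite /block_at; elim: (box N) => [|q s IH].
    under eq_cvg do rewrite big_nil.
    by rewrite big_nil; exact: cvg_cst.
  under eq_cvg do rewrite big_cons.
  rewrite big_cons; apply: cvgD => //.
  by apply: cvgM; [exact: cvg_cst|apply: cvgM; [exact: cvg_cst|exact: vw]].
rewrite -(cvg_lim _ (cvg_norm cv))//; apply: limr_le.
  by apply: cvgP (cvg_norm cv).
by apply: nearW => M.
Qed.

(** Comparable to the modulus of [fourier u k], and a pointwise bound for [mode u k]. *)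
Definition height u k : R := `|cosc u k| + `|sinc u k|.

Lemma height_ge0 u k : 0 <= height u k.
Proof. by rewrite addr_ge0. Qed.

Lemma le_mode u k x : `|mode u k x| <= height u k.
Proof. exact: le_trig. Qed.

Lemma continuous_mode u k : continuous (mode u k).
Proof. exact: continuous_trig. Qed.

(* Each product of modes has two frequencies [k + l] and [k - l], and each of
   them meets at most two kernel frequencies [q]. *)
Lemma block_at_modeM n N u k l x :
  `|block_at n N (fun phi => \int[torus R]_y (mode u k y * mode u l y * phi y)) x|
  <= 4 * (height u k * height u l).
Proof.
have t0 := tau_gt0 R.
set a := cosc u k; set b := sinc u k; set c := cosc u l; set d := sinc u l.
set hh := height u k * height u l.
have hh0 : 0 <= hh by rewrite mulr_ge0 ?height_ge0.
have small (a1 b1 : R) p q : `|a1| + `|b1| <= hh ->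
    `|\int[torus R]_y (trig p a1 b1 y *
       trig q (cos (angle q x)) (sin (angle q x)) y)| <=
    tau * hh * ((if q == - p then 1 else 0) + (if q == p then 1 else 0)).
  move=> h; apply: (le_trans (le_int_trigM _ _ _ _ _ _)).
  rewrite -eqr_oppLR [- p == q]eq_sym [p == q]eq_sym; apply: ler_wpM2r.
    by apply: addr_ge0; case: ifP.
  rewrite -mulrA ler_pM2l// ler_pdivrMr//; apply: ler_pM => //.
  have : `|cos (angle q x)| <= 1 by rewrite ler_norml cos_geN1 cos_le1.
  have : `|sin (angle q x)| <= 1 by rewrite ler_norml sin_geN1 sin_le1.
  lra.
have B : `|a| * `|c| + `|b| * `|d| + `|a| * `|d| + `|b| * `|c| = hh.
  by rewrite /hh /height -/a -/b -/c -/d; ring.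
have n2 (y z : R) : `|y| + `|z| <= hh *+ 2 -> `|y / 2| + `|z / 2| <= hh.
  by rewrite !normrM (ger0_norm (x := 2^-1))// mulr2n; lra.
have tr : `|a * c - b * d| <= `|a| * `|c| + `|b| * `|d|.
  by apply: (le_trans (ler_normB _ _)); rewrite !normrM.
have tr2 : `|a * c + b * d| <= `|a| * `|c| + `|b| * `|d|.
  by apply: (le_trans (ler_normD _ _)); rewrite !normrM.
have tr3 : `|a * d + b * c| <= `|a| * `|d| + `|b| * `|c|.
  by apply: (le_trans (ler_normD _ _)); rewrite !normrM.
have tr4 : `|b * c - a * d| <= `|a| * `|d| + `|b| * `|c|.
  by apply: (le_trans (ler_normB _ _)); rewrite !normrM addrC.
have s1 q := small _ _ (k + l) q (n2 (a * c - b * d) (a * d + b * c) ltac:(rewrite mulr2n; lra)).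
have s2 q := small _ _ (k - l) q (n2 (a * c + b * d) (b * c - a * d) ltac:(rewrite mulr2n; lra)).
pose dl (p q : int * int) : R := if q == p then 1 else 0.
have dl1 p : \sum_(q <- box N) dl p q <= 1.
  rewrite (eq_bigr (fun q => if q == p then (fun=> 1) q else 0))// sum_box1.
  by case: ifP.
have dl0 p q : 0 <= dl p q by rewrite /dl; case: ifP.
apply: (@le_trans _ _ (\sum_(q <- box N) hh *
    ((dl (- (k + l)) q + dl (k + l) q) + (dl (- (k - l)) q + dl (k - l) q)))).
  apply: (le_trans (ler_norm_sum _ _ _)); apply: ler_sum => q _.
  rewrite normrM (ger0_norm (lp_mult_ge0 _ _ _)) -[leRHS]mul1r.
  apply: ler_pM => //; [exact: lp_mult_ge0|exact: lp_mult_le1|].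
  rewrite normrM gtr0_norm ?invr_gt0// ler_pdivrMl//.
  under eq_Rintegral do rewrite /mode trigM mulrDl.
  rewrite tintD; try by apply/intg_cont/contM; exact: continuous_trig.
  apply: (le_trans (ler_normD _ _)); rewrite [leRHS]mulrA [leRHS]mulrDr.
  by apply: lerD; [exact: s1|exact: s2].
rewrite -mulr_sumr mulrC ler_wpM2r// !big_split/=.
have := dl1 (- (k + l)); have := dl1 (k + l); have := dl1 (- (k - l)); have := dl1 (k - l).
lra.
Qed.

End Blocks.

(** * The resonating term *)

Section Resonance.
Variables (R : realType) (P : dyadic_partition R).
Implicit Types (u g w : distr R) (k l q : int * int) (n N M B c r : nat).
Implicit Types (om : int * int -> int * int -> R) (x : R * R).
Local Notation m := (lp_mult P).
Local Notation lam := (@lam R).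
Local Notation tau := (@tau R).

(** The double Fourier series of u times Ku, with a free weight: [reson_wt N] yields the partial
    sums of the resonating term, and differences of weights yield differences of sums. *)
Definition dsum om u B x : R := \sum_(k <- box B) \sum_(l <- box B)
  om k l * (lam l * (mode u k x * mode u l x)).

Lemma dsumB om om' u B x :
  dsum om u B x - dsum om' u B x = dsum (fun k l => om k l - om' k l) u B x.
Proof.
rewrite /dsum -sumrB; apply: eq_bigr => k _.
by rewrite -sumrB; apply: eq_bigr => l _; rewrite mulrBl.
Qed.

Lemma continuous_modeM u k l : continuous (fun x => mode u k x * mode u l x).
Proof. by apply: contM; exact: continuous_mode. Qed.

Lemma continuous_dsum om u B : continuous (dsum om u B).
Proof.
apply: cont_sum => k; apply: cont_sum => l; do 2 apply: contZ.
exact: continuous_modeM.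
Qed.

Lemma le_dsum om u B x : `|dsum om u B x| <= diag_sum om (height u) B.
Proof.
apply: (le_trans (ler_norm_sum _ _ _)); apply: ler_sum => k _.
apply: (le_trans (ler_norm_sum _ _ _)); apply: ler_sum => l _.
rewrite normrM ler_wpM2l// normrM (ger0_norm (lam_ge0 _ _)) ler_wpM2l ?lam_ge0//.
by rewrite normrM; apply: ler_pM => //; exact: le_mode.
Qed.

Lemma tint_dsum om u B (phi : test R) : \int[torus R]_x (dsum om u B x * phi x) =
  \sum_(k <- box B) \sum_(l <- box B)
    om k l * (lam l * \int[torus R]_x (mode u k x * mode u l x * phi x)).
Proof.
have cI k l : continuous (fun x => mode u k x * mode u l x * phi x).
  by apply: contM; [exact: continuous_modeM|exact: continuous_test].
have -> : (fun x => dsum om u B x * phi x) = fun x =>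
    \sum_(k <- box B) \sum_(l <- box B)
      om k l * (lam l * (mode u k x * mode u l x * phi x)).
  apply/funext => x; rewrite mulr_suml; apply: eq_bigr => k _.
  by rewrite mulr_suml; apply: eq_bigr => l _; rewrite !mulrA.
rewrite tint_sum => [|k]; last by apply: intg_sum => l; exact/intgZ/intgZ/intg_cont.
apply: eq_bigr => k _; rewrite tint_sum => [|l]; last exact/intgZ/intgZ/intg_cont.
by apply: eq_bigr => l _; rewrite !tintZ//; [exact: intg_cont|exact/intgZ/intg_cont].
Qed.

Lemma block_at_dsum n N om u B x :
  `|block_at P n N (fun phi => \int[torus R]_y (dsum om u B y * phi y)) x| <=
  4 * diag_sum om (height u) B.
Proof.
have -> : block_at P n N (fun phi => \int[torus R]_y (dsum om u B y * phi y)) x =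
  \sum_(k <- box B) \sum_(l <- box B) om k l * (lam l *
    block_at P n N (fun phi => \int[torus R]_y (mode u k y * mode u l y * phi y)) x).
  rewrite /block_at; under eq_bigr do rewrite tint_dsum mulr_sumr mulr_sumr.
  rewrite exchange_big; apply: eq_bigr => k _.
  under eq_bigr do rewrite mulr_sumr mulr_sumr.
  rewrite exchange_big; apply: eq_bigr => l _.
  by rewrite !mulr_sumr; apply: eq_bigr => q _; ring.
apply: (le_trans (ler_norm_sum _ _ _)); rewrite mulr_sumr; apply: ler_sum => k _.
apply: (le_trans (ler_norm_sum _ _ _)); rewrite mulr_sumr; apply: ler_sum => l _.
rewrite normrM mulrCA ler_wpM2l// normrM (ger0_norm (lam_ge0 _ _)).
by rewrite mulrCA ler_wpM2l ?lam_ge0// block_at_modeM.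
Qed.

Lemma in_box_exists n : exists N, in_box P n N.
Proof.
have [kp [_ h]] := lp_mult_supp P.
by exists (kp * 2 ^ n)%N => k /h[].
Qed.

(** The bound is uniform in the block, in the point and in the boxes [B N]. With r = 0 it controls
    the norm of a resonating term; with r large, the tail [E] makes it small. *)
Lemma lp_block_dsum_le c r (om : nat -> int * int -> int * int -> R) (B : nat -> nat) u w E :
  height u 0 = 0 -> (forall N, near_diag c r (om N)) ->
  (forall N, \sum_(k <- box N | (r <= nrm k)%N) height u k ^+ 2 <= E) ->
  (forall phi : test R,
    \int[torus R]_x (dsum (om N) u (B N) x * phi x) @[N --> \oo] --> w phi) ->
  forall n x, `|lp_block P n w x| <= 4 * (diag_cst R c * E).
Proof.
move=> u0 nd hE cw n x; have [N nN] := in_box_exists n.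
rewrite (lp_block_at _ _ nN); apply: block_at_lim cw _ => M.
apply: (le_trans (block_at_dsum _ _ _ _ _ _)); rewrite ler_wpM2l//.
apply: (le_trans (diag_sum_le _ (nd M) (height_ge0 u) u0)).
by rewrite ler_wpM2l// /diag_cst ler0n.
Qed.

Definition reson_wt N k l : R :=
  \sum_(i < N) \sum_(j < N | (`|i - j| <= 1)%N) m i k * m j l.

Lemma reson_wt_ge0 N k l : 0 <= reson_wt N k l.
Proof. by do 2 apply: sumr_ge0 => ? _; rewrite mulr_ge0 ?lp_mult_ge0. Qed.

Lemma reson_wt_le1 N k l : reson_wt N k l <= 1.
Proof.
apply: (@le_trans _ _ (\sum_(i < N) m i k * \sum_(j < N) m j l)).
  apply: ler_sum => i _; rewrite mulr_sumr big_mkcond/=; apply: ler_sum => j _.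
  by case: ifP => // _; rewrite mulr_ge0 ?lp_mult_ge0.
rewrite -mulr_suml -[leRHS]mulr1; apply: ler_pM; rewrite ?sum_lp_mult//;
  by apply: sumr_ge0 => i _; exact: lp_mult_ge0.
Qed.

Lemma sum2_narrow N M (p : nat -> nat -> bool) (F : nat -> nat -> R) : (M <= N)%N ->
  (forall i j, p i j -> (M <= i)%N || (M <= j)%N -> F i j = 0) ->
  \sum_(i < N) \sum_(j < N | p i j) F i j = \sum_(i < M) \sum_(j < M | p i j) F i j.
Proof.
move=> MN F0; rewrite (bigID (fun i : 'I_N => (i < M)%N))/= [X in _ + X]big1 ?addr0.
  rewrite -(big_ord_widen _ (fun i => \sum_(j < N | p i j) F i j) MN).
  apply: eq_bigr => i _; rewrite (bigID (fun j : 'I_N => (j < M)%N))/=.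
  rewrite [X in _ + X]big1 ?addr0 => [|j /andP[pij jM]].
    by rewrite (big_ord_widen_cond _ (fun j => p i j) (fun j => F i j) MN).
  by apply: F0 => //; rewrite [X in _ || X]leqNgt jM orbT.
by move=> i iM; apply: big1 => j pij; apply: F0 => //; rewrite leqNgt iM.
Qed.

(** If blocks i and j with |i - j| <= 1 see k and l, then |k| <= kp 2^i <= 2 kp 2^j <= 2 kp^2 |l|,
    and symmetrically; hence c = 2 kp^2. Two partial sums differ only by pairs of high blocks, which
    see only high frequencies. *)
Lemma reson_wt_near : exists c, (0 < c)%N /\
  (forall N, near_diag c 0 (reson_wt N)) /\
  forall r, exists M, forall N, (M <= N)%N ->
    near_diag c r (fun k l => reson_wt N k l - reson_wt M k l).
Proof.
have [kp [kp0 hm]] := lp_mult_supp P.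
have term k l (i j : nat) : k != 0 -> l != 0 -> (`|i - j| <= 1)%N -> m i k * m j l != 0 ->
    [/\ (nrm k <= 2 * kp ^ 2 * nrm l)%N, (nrm l <= 2 * kp ^ 2 * nrm k)%N,
        (2 ^ i <= kp * nrm k)%N & (2 ^ j <= kp * nrm l)%N].
  move=> k0 l0 ij; rewrite mulf_eq0 negb_or => /andP[/hm[h1 /(_ k0) h2] /hm[h3 /(_ l0) h4]].
  have ij2 : (2 ^ i <= 2 * 2 ^ j)%N by rewrite -expnS leq_exp2l//; lia.
  have ji2 : (2 ^ j <= 2 * 2 ^ i)%N by rewrite -expnS leq_exp2l//; lia.
  by split => //; move: (2 ^ i)%N (2 ^ j)%N h1 h2 h3 h4 ij2 ji2 => p q *; nia.
have wt0 N k l : k != 0 -> l != 0 -> reson_wt N k l != 0 ->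
    (nrm k <= 2 * kp ^ 2 * nrm l)%N /\ (nrm l <= 2 * kp ^ 2 * nrm k)%N.
  move=> k0 l0; apply: contra_neqP => h; apply: big1 => i _; apply: big1 => j ij.
  by apply: contra_notP h => /eqP /(term _ _ _ _ k0 l0 ij)[].
exists (2 * kp ^ 2)%N; split; first by rewrite muln_gt0/= expn_gt0 kp0.
split=> [N|r].
  split=> k l; first by rewrite ger0_norm ?reson_wt_ge0// reson_wt_le1.
  by move=> k0 l0 /(wt0 _ _ _ k0 l0)[].
(* If i or j is at least M, both are at least M - 1, so 2 kp r = M < 2^M <= 2 * 2^i <= 2 kp |k|, and
   likewise for l. *)
exists (2 * kp * r)%N => N MN; set M := (2 * kp * r)%N; split=> k l.
  have := reson_wt_ge0 N k l; have := reson_wt_le1 N k l.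
  have := reson_wt_ge0 M k l; have := reson_wt_le1 M k l.
  by rewrite ler_norml => *; apply/andP; split; lra.
move=> k0 l0 d0.
have [c1 c2] : (nrm k <= 2 * kp ^ 2 * nrm l)%N /\ (nrm l <= 2 * kp ^ 2 * nrm k)%N.
  have [e|] := eqVneq (reson_wt N k l) 0; last exact: wt0.
  have [e'|] := eqVneq (reson_wt M k l) 0; last exact: wt0.
  by move: d0; rewrite e e' subrr eqxx.
have big : (r <= nrm k)%N /\ (r <= nrm l)%N.
  apply: contra_neqP d0 => h; apply/eqP; rewrite subr_eq0; apply/eqP.
  apply: (@sum2_narrow N M (fun i j => (`|i - j| <= 1)%N) (fun i j => m i k * m j l)) => //.
  move=> i j ij Mij; apply: contra_notP h => /eqP /(term _ _ _ _ k0 l0 ij)[_ _ h1 h2].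
  have hi : (2 ^ M <= 2 * 2 ^ i)%N by rewrite -expnS leq_exp2l//; lia.
  have hj : (2 ^ M <= 2 * 2 ^ j)%N by rewrite -expnS leq_exp2l//; lia.
  have hM : (2 * kp * r < 2 ^ M)%N by exact: ltn_expl.
  have kr a : (kp * r < kp * a)%N -> (r <= a)%N by rewrite ltn_pmul2l// => /ltnW.
  move: (2 ^ M)%N (2 ^ i)%N (2 ^ j)%N hM hi hj h1 h2 => p q s hM hi hj h1 h2.
  by split; apply: kr; nia.
by split; case: big.
Qed.

End Resonance.

(** * Existence of Kh and of the resonating term; truncation *)

Section Existence.
Variables (R : realType) (P : dyadic_partition R).
Implicit Types (u g w : distr R) (k l q : int * int) (n N M B c r : nat).
Implicit Types (x : R * R) (h : R * R -> R).
Local Notation m := (lp_mult P).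
Local Notation lam := (@lam R).
Local Notation tau := (@tau R).

Lemma in_box_all : exists Bf : nat -> nat,
  forall N M n, (n < N)%N -> (N <= M)%N -> in_box P n (Bf M).
Proof.
have [kp [kp0 h]] := lp_mult_supp P.
exists (fun N => kp * 2 ^ N)%N => N M n nN NM k /h[+ _] => /leq_trans; apply.
by rewrite leq_pmul2l// leq_exp2l// ltnW// (leq_trans nN).
Qed.

Lemma mode_green u g k x : inverse_laplacian u g -> mode g k x = lam k * mode u k x.
Proof.
by move=> /inverse_laplacianP/(_ k)[e1 e2]; rewrite /mode e1 e2 /trig; ring.
Qed.

(** Any sufficiently large box [B] is allowed, so that two partial sums can be written over the same
    box and subtracted. *)
Lemma reson_dsum u g N B x : inverse_laplacian u g ->
  (forall n, (n < N)%N -> in_box P n B) ->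
  \sum_(i < N) \sum_(j < N | (`|i - j| <= 1)%N) lp_block P i u x * lp_block P j g x =
  dsum (reson_wt P N) u B x.
Proof.
move=> ug nB.
transitivity (\sum_(i < N) \sum_(j < N | (`|i - j| <= 1)%N)
    \sum_(k <- box B) \sum_(l <- box B)
      m i k * m j l * (lam l * (mode u k x * mode u l x))).
  apply: eq_bigr => i _; apply: eq_bigr => j _.
  rewrite (lp_block_box _ _ (nB i (ltn_ord i))) (lp_block_box _ _ (nB j (ltn_ord j))).
  rewrite mulr_suml; apply: eq_bigr => k _; rewrite mulr_sumr; apply: eq_bigr => l _.
  by rewrite (mode_green _ _ ug); ring.
under eq_bigr do rewrite exchange_big.
rewrite exchange_big; apply: eq_bigr => k _.
under eq_bigr do rewrite exchange_big.
rewrite exchange_big; apply: eq_bigr => l _.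
by rewrite /reson_wt mulr_suml; apply: eq_bigr => i _; rewrite mulr_suml.
Qed.

Lemma sum_box_diff (F : int * int -> R) N M : (M <= N)%N ->
  \sum_(k <- box N) F k - \sum_(k <- box M) F k =
  \sum_(k <- box N | (M < nrm k)%N) F k.
Proof.
move=> MN; rewrite (bigID (fun k => (nrm k <= M)%N))/=.
have -> : \sum_(k <- box N | (nrm k <= M)%N) F k = \sum_(k <- box M) F k.
  rewrite big_mkcond (@sum_box_widen _ M N)//; last first.
    by move=> k; rewrite ltnNge => /negbTE ->.
  by rewrite big_seq [RHS]big_seq; apply: eq_bigr => k; rewrite mem_box => ->.
by rewrite addrAC subrr add0r; apply: eq_bigl => k; rewrite ltnNge.
Qed.

(** Square-summable Fourier coefficients: the form in which membership of [h] in L^2 enters the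
    estimates. *)
Definition height_bound u : Prop :=
  exists E : R, forall N, \sum_(k <- box N) height u k ^+ 2 <= E.

Lemma height_sqr_le u k : height u k ^+ 2 <= 2 * (cosc u k ^+ 2 + sinc u k ^+ 2).
Proof.
rewrite /height -(real_normK (num_real (cosc u k))) -(real_normK (num_real (sinc u k))).
by have := sqr_ge0 (`|cosc u k| - `|sinc u k|); lra.
Qed.

Lemma L2_height_bound h u : isL2 h -> represents h u -> height_bound u.
Proof.
move=> hh hu; have [E hE] := bessel hh hu; exists (2 * E) => N.
apply: (@le_trans _ _ (\sum_(k <- box N) 2 * (cosc u k ^+ 2 + sinc u k ^+ 2))).
  by apply: ler_sum => k _; exact: height_sqr_le.
by rewrite -mulr_sumr ler_wpM2l.
Qed.

(** By |lam H| <= lam^2 + H^2 the Fourier series of Kh converges uniformly, so [distr_lim]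
    applies. *)
Lemma green_exists u : height_bound u -> exists g, inverse_laplacian u g.
Proof.
move=> [E hE]; pose F N x := \sum_(k <- box N) trig k (lam k * cosc u k) (lam k * sinc u k) x.
have cF N : continuous (F N) by apply: cont_sum => k; exact: continuous_trig.
have FE k x : `|trig k (lam k * cosc u k) (lam k * sinc u k) x| <=
    lam k ^+ 2 + height u k ^+ 2.
  apply: (le_trans (le_trig _ _ _ _)).
  rewrite !(normrM (lam k)) -mulrDr (ger0_norm (lam_ge0 _ _)) -/(height u k).
  have := sqr_ge0 (lam k - height u k); have := lam_ge0 R k; have := height_ge0 u k.
  move=> p1 p2; have := mulr_ge0 p1 p2; lra.
have Fc (e : R) : 0 < e -> exists M, forall N x, (M <= N)%N -> `|F N x - F M x| <= e.
  have F0 k : 0 <= lam k ^+ 2 + height u k ^+ 2 by rewrite addr_ge0 ?sqr_ge0.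
  have FB N : \sum_(k <- box N) (lam k ^+ 2 + height u k ^+ 2) <= 75 + E.
    by rewrite big_split/= lerD// sum_lam_sqr.
  move=> e0; have [r hr] := tail_small F0 FB e0.
  exists r => N x rN; rewrite sum_box_diff//; apply: le_trans (hr N).
  apply: (le_trans (ler_norm_sum _ _ _)).
  rewrite big_mkcond [leRHS]big_mkcond; apply: ler_sum => k _.
  by case: ifP => [/ltnW ->|_]; [exact: FE|case: ifP].
have [g hg] := distr_lim cF Fc; exists g; apply/inverse_laplacianP => q.
have t0 := lt0r_neq0 (tau_gt0 R).
have key (c d : R) : g (trig_test q c d) = tau * (lam q * cosc u q * c + lam q * sinc u q * d).
  apply/esym; apply: (@cvg_unique _ (@Rhausdorff R) _ _ _ _ _ (hg (trig_test q c d))).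
  (* Once N >= |q|, orthogonality makes the integral independent of N. *)
  apply: cvg_near_cst; near=> N.
  have -> : \int[torus R]_x (F N x * trig_test q c d x) = \int[torus R]_x
      (\sum_(k <- box N) trig k (lam k * cosc u k) (lam k * sinc u k) x * trig q c d x).
    by apply: eq_Rintegral => x _; rewrite /F mulr_suml.
  rewrite int_box_trigM.
  - by rewrite ifT//; near: N; exists (nrm q).
  - by move=> k; rewrite lamN coscN.
  - by move=> k; rewrite lamN sincN mulrN.
split; [rewrite [LHS]/cosc|rewrite [LHS]/sinc].
  have -> : cos_test R q = trig_test q 1 0 by [].
  by rewrite key mulKf// mulr1 mulr0 addr0.
have -> : sin_test R q = trig_test q 0 1 by [].
by rewrite key mulKf// mulr1 mulr0 add0r.
Unshelve. all: by end_near. Qed.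

Lemma height_bound_tail u : height_bound u -> forall e : R, 0 < e ->
  exists r, forall N, \sum_(k <- box N | (r <= nrm k)%N) height u k ^+ 2 <= e.
Proof. by move=> [E hE]; apply: tail_small => // k; exact: sqr_ge0. Qed.

(** The difference of two partial sums is a [dsum] whose weight is cut off below [r], so a tail of
    the sum of squares bounds it uniformly in x. *)
Lemma reson_exists u g : height_bound u -> height u 0 = 0 -> inverse_laplacian u g ->
  exists w, resonating P u g w.
Proof.
move=> hb u0 ug; have [Bf hB] := in_box_all; have [c [c0 [_ nd]]] := reson_wt_near P.
pose F N x := \sum_(i < N) \sum_(j < N | (`|i - j| <= 1)%N)
  lp_block P i u x * lp_block P j g x.
have FE N M x : (N <= M)%N -> F N x = dsum (reson_wt P N) u (Bf M) x.
  by move=> NM; apply: reson_dsum => // n nN; exact: hB nN NM.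
apply: distr_lim.
  move=> N; rewrite (_ : (fun x => _) = dsum (reson_wt P N) u (Bf N)).
    exact: continuous_dsum.
  by apply/funext => x; exact: FE.
move=> e e0; have d0 : 0 < diag_cst R c.
  by rewrite /diag_cst ltr0n muln_gt0 /= expn_gt0.
have [r hr] := height_bound_tail hb (divr_gt0 e0 d0).
have [M hM] := nd r; exists M => N x MN.
rewrite -/(F N x) -/(F M x) (FE N N x (leqnn N)) (FE M N x MN) dsumB.
apply: (le_trans (le_dsum _ _ _ _)).
apply: (le_trans (diag_sum_le _ (hM N MN) (height_ge0 u) u0)).
by rewrite mulrC -ler_pdivlMr.
Qed.

Lemma resonating_dsum u g w : inverse_laplacian u g -> resonating P u g w ->
  exists Bf, forall phi : test R,
    \int[torus R]_x (dsum (reson_wt P N) u (Bf N) x * phi x) @[N --> \oo] --> w phi.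
Proof.
move=> ug hw; have [Bf hB] := in_box_all; exists Bf => phi.
rewrite (_ : (fun N => _) = fun N => \int[torus R]_x ((\sum_(i < N) \sum_(j < N |
  (`|i - j| <= 1)%N) lp_block P i u x * lp_block P j g x) * phi x)); first exact: hw.
apply/funext => N; apply: eq_Rintegral => x _; congr (_ * _); apply/esym.
by apply: reson_dsum => // n nN; exact: hB nN (leqnn N).
Qed.

Lemma lp_block_reson_le : exists C : R, 0 < C /\ forall u g w E,
  inverse_laplacian u g -> resonating P u g w -> height u 0 = 0 ->
  (forall N, \sum_(k <- box N) height u k ^+ 2 <= E) ->
  forall n x, `|lp_block P n w x| <= C * E.
Proof.
have [c [c0 [nd _]]] := reson_wt_near P.
exists (4 * diag_cst R c); split.
  by rewrite mulr_gt0// /diag_cst ltr0n muln_gt0 /= expn_gt0.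
move=> u g w E ug hw u0 hE n x; have [Bf cw] := resonating_dsum ug hw.
rewrite -mulrA; apply: (@lp_block_dsum_le _ P c 0 _ Bf u w E u0 nd) => //.
Qed.

(** Phrased through coefficients, it applies to every distribution representing the truncated
    series. *)
Definition cut M u u' : Prop := forall k,
  cosc u' k = (if (nrm k <= M)%N then cosc u k else 0) /\
  sinc u' k = (if (nrm k <= M)%N then sinc u k else 0).

(** With [i] the indicator of the box, the pairs lost by truncation carry the weight 1 - i k i l. It
    vanishes unless one frequency exceeds M, and near the diagonal the other is then large too. *)
Lemma lp_block_reson_cut u g w (e : R) : inverse_laplacian u g -> resonating P u g w ->
  height u 0 = 0 -> height_bound u -> 0 < e ->
  exists r, forall M u' g' w', (r <= M)%N -> cut M u u' -> inverse_laplacian u' g' ->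
    resonating P u' g' w' -> forall n x, `|lp_block P n (w - w') x| <= e.
Proof.
move=> ug hw u0 hb e0; have [c [c0 [nd _]]] := reson_wt_near P.
have C0 : 0 < 4 * diag_cst R c.
  by rewrite mulr_gt0// /diag_cst ltr0n muln_gt0 /= expn_gt0.
have [r hr] := height_bound_tail hb (divr_gt0 e0 C0).
(* One frequency exceeds c r, so comparability leaves at least r for the other. *)
exists (c * r)%N => M u' g' w' rM cu ug' hw' n x.
pose i k : R := if (nrm k <= M)%N then 1 else 0.
have modeE k y : mode u' k y = i k * mode u k y.
  by rewrite /mode; have [-> ->] := cu k; rewrite /i /trig; case: ifP => _; ring.
have [Bf hB] := in_box_all.
pose om N k l := reson_wt P N k l * (1 - i k * i l).
have ndom N : near_diag c r (om N).
  have [n1 n2] := nd N; split=> k l.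
    rewrite /om /i; case: ifP => _; case: ifP => _;
      by rewrite ?(mul0r, mulr0, subr0, mulr1, subrr, normr0) ?ler01.
  move=> k0 l0; rewrite mulf_eq0 negb_or => /andP[/(n2 _ _ k0 l0)[h1 h2 _ _] h].
  have : (M < nrm k)%N \/ (M < nrm l)%N.
    move: h; rewrite /i; case: leqP => hk; case: leqP => hl; try by [left|right].
    by rewrite mulr1 subrr eqxx.
  have kr a : (c * r < c * a)%N -> (r <= a)%N by rewrite ltn_pmul2l// => /ltnW.
  by case=> hM; split => //; first [apply: kr; nia|nia].
rewrite (_ : e = 4 * (diag_cst R c * (e / (4 * diag_cst R c)))); last first.
  by rewrite mulrA mulrC divfK// lt0r_neq0.
apply: (@lp_block_dsum_le _ P c r om Bf u (w - w')) => // phi.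
have -> : (w - w' : distr R) phi = w phi - w' phi by [].
rewrite (_ : (fun N => _) = fun N =>
  \int[torus R]_x ((\sum_(i < N) \sum_(j < N | (`|i - j| <= 1)%N)
      lp_block P i u x * lp_block P j g x) * phi x) -
  \int[torus R]_x ((\sum_(i < N) \sum_(j < N | (`|i - j| <= 1)%N)
      lp_block P i u' x * lp_block P j g' x) * phi x)).
  by apply: cvgB; [exact: hw|exact: hw'].
apply/funext => N; have nB : forall n, (n < N)%N -> in_box P n (Bf N).
  by move=> j jN; exact: hB jN (leqnn N).
have E1 y : \sum_(i < N) \sum_(j < N | (`|i - j| <= 1)%N)
    lp_block P i u y * lp_block P j g y = dsum (reson_wt P N) u (Bf N) y.
  exact: reson_dsum.
have E2 y : \sum_(i < N) \sum_(j < N | (`|i - j| <= 1)%N)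
    lp_block P i u' y * lp_block P j g' y = dsum (reson_wt P N) u' (Bf N) y.
  exact: reson_dsum.
under [in RHS]eq_Rintegral do rewrite E1.
under [X in _ = _ - X]eq_Rintegral do rewrite E2.
have I1 om' v : intg (fun x => dsum om' v (Bf N) x * phi x).
  by apply/intg_cont/contM; [exact: continuous_dsum|exact: continuous_test].
rewrite -mulN1r -tintZ// -tintD//; last exact: intgZ.
apply: eq_Rintegral => y _; rewrite mulN1r -mulrBl; congr (_ * _).
rewrite /dsum -sumrB; apply: eq_bigr => k _; rewrite -sumrB; apply: eq_bigr => l _.
by rewrite !modeE /om; ring.
Qed.

Lemma test_sumE I (s : seq I) (f : I -> test R) x :
  (\sum_(i <- s) f i : test R) x = \sum_(i <- s) f i x.
Proof.
elim: s => [|i s IH]; first by rewrite !big_nil.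
by rewrite !big_cons -IH.
Qed.

(** The Fourier polynomial of [h] over the box is a test function; its mean vanishes because the
    coefficient of [h] at 0 does. *)
Lemma cut_exists h u M : zero_mean h -> represents h u ->
  exists theta u', [/\ isL2 (theta : test R), zero_mean theta,
    represents theta u' & cut M u u'].
Proof.
move=> hz hu; pose theta : test R := \sum_(k <- box M) trig_test k (cosc u k) (sinc u k).
have thE x : theta x = \sum_(k <- box M) mode u k x by rewrite test_sumE.
have th2 : isL2 theta by apply: continuous_Lfun2; exact: continuous_test.
have [u' hu'] := L2_distr th2; exists theta, u'.
have t0 := lt0r_neq0 (tau_gt0 R).
split => //.
  rewrite /zero_mean; under eq_Rintegral do rewrite thE.
  rewrite tint_sum => [|k]; last exact/intg_cont/continuous_mode.
  apply: big1 => k _; rewrite /mode int_trig; case: eqP => // ->.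
  by rewrite (cosc0 hu hz) mulr0.
have key q (c d : R) : u' (trig_test q c d) =
    if (nrm q <= M)%N then tau * (cosc u q * c + sinc u q * d) else 0.
  rewrite hu' -(@int_box_trigM _ M q (cosc u) (sinc u))//; last 2 first.
  - exact: coscN.
  - exact: sincN.
  by apply: eq_Rintegral => x _; rewrite thE mulr_suml.
move=> q; split; [rewrite [LHS]/cosc|rewrite [LHS]/sinc].
  have -> : cos_test R q = trig_test q 1 0 by [].
  rewrite key; case: ifP => _; last by rewrite mulr0.
  by rewrite mulKf// mulr1 mulr0 addr0.
have -> : sin_test R q = trig_test q 0 1 by [].
rewrite key; case: ifP => _; last by rewrite mulr0.
by rewrite mulKf// mulr1 mulr0 add0r.
Qed.

Lemma height_cut M u u' k : cut M u u' ->
  height (u - u') k = if (M < nrm k)%N then height u k else 0.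
Proof.
move=> cu; rewrite /height coscB sincB; have [-> ->] := cu k.
by case: leqP => _; rewrite ?subrr ?subr0 ?normr0 ?addr0.
Qed.

Lemma height0 h u : represents h u -> zero_mean h -> height u 0 = 0.
Proof. by move=> hu hz; rewrite /height (cosc0 hu hz) sinc0 normr0 addr0. Qed.

End Existence.

(** * Besov norms *)

Section BesovBounds.
Variables (R : realType) (P : dyadic_partition R).
Implicit Types (u g w : distr R) (k : int * int) (n N : nat) (x : R * R).
Local Notation mR2 := (measurableTypeR R * measurableTypeR R)%type.
Local Notation tau := (@tau R).

Lemma torus_gt0 : (0 < torus R setT)%E.
Proof. by rewrite torus_setT lte_fin; exact: tau_gt0. Qed.

Lemma Lnormy_le (f : R * R -> R) E : (forall x, `|f x| <= E) ->
  ('N[torus R]_+oo [EFin \o (f : mR2 -> R)] <= E%:E)%E.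
Proof.
move=> fE; rewrite unlock torus_gt0; apply/ess_supP/nearW => x /=.
by rewrite lee_fin.
Qed.

Lemma tint_Lnormy (f : R * R -> R) E : intg f -> 0 <= E ->
  ('N[torus R]_+oo [EFin \o (f : mR2 -> R)] <= E%:E)%E ->
  `|\int[torus R]_x f x| <= tau * E.
Proof.
move=> If E0; rewrite unlock torus_gt0 => /ess_supP fE.
have Ia : intg (fun x => `|f x|) by move/integrable_abse : If.
apply: (le_trans (le_normr_Rintegral measurableT If)).
have iE : (\int[torus R]_x (E%:E) = (tau * E)%:E)%E.
  by rewrite integral_cst// torus_setT EFinM muleC.
rewrite -lee_fin -iE /Rintegral fineK; last exact: integrable_fin_num Ia.
apply: ae_ge0_le_integral => //; first exact: measurable_int Ia.
by apply: filterS fE => x /= fx _.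
Qed.

Lemma besov_norm_le beta f E :
  (forall n x, 2 `^ ((n%:R - 1) * beta) * `|lp_block P n f x| <= E) ->
  (besov_norm P beta f <= E%:E)%E.
Proof.
move=> h; apply: ge_ereal_sup => _ [n _ <-].
have w0 : 0 < 2 `^ ((n%:R - 1) * beta) :> R by rewrite powR_gt0.
have -> : E = 2 `^ ((n%:R - 1) * beta) * (E / 2 `^ ((n%:R - 1) * beta)).
  by rewrite mulrC divfK// lt0r_neq0.
rewrite EFinM; apply: lee_wpmul2l; first by rewrite lee_fin ltW.
by apply: Lnormy_le => x; rewrite ler_pdivlMr// mulrC.
Qed.

Lemma powR2_sub2 n : 2 `^ (2 - n%:R) * 2 ^+ n = 4 :> R.
Proof.
rewrite -powR_mulrn// -powRD ?subrK; last by rewrite pnatr_eq0 implybT.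
by rewrite (powR_mulrn 2)//; ring.
Qed.

(** For 0 <= alpha <= 1 the weight (n - 1)(alpha - 2) is at most 2 - n in the exponent, and 2^(2 -
    n) 2^n = 4. The margin is there for n = 0, the block Delta_(-1). *)
Lemma besov_norm_le_L2 alpha u (K e : R) : 2 / 3 < alpha < 1 -> 0 <= K ->
  (forall n x, `|lp_block P n u x| <= 2 ^+ n * (K * e)) -> 0 <= e ->
  (besov_norm P (alpha - 2) u <= (4 * (K * e))%:E)%E.
Proof.
move=> /andP[a0 a1] K0 h e0; apply: besov_norm_le => n x.
rewrite -(powR2_sub2 n) -mulrA; apply: ler_pM => //.
apply: ler_powR; first by rewrite ler1n.
case: n {h} => [|n]; first lra.
by rewrite -natr1; have : 0 <= n%:R :> R by []; nra.
Qed.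

(** As 2 alpha - 2 < 0, the weights are at most 1 for n >= 1; the factor 2 covers n = 0, where the
    weight is 2^(2 - 2 alpha). *)
Lemma besov_norm_le_reson alpha w (e : R) : 2 / 3 < alpha < 1 ->
  (forall n x, `|lp_block P n w x| <= e) ->
  (besov_norm P (2 * alpha - 2) w <= (2 * e)%:E)%E.
Proof.
move=> /andP[a0 a1] h; apply: besov_norm_le => n x.
apply: ler_pM => //.
rewrite -[leRHS]powRr1//; apply: ler_powR; first by rewrite ler1n.
case: n {h} => [|n]; first lra.
by rewrite -natr1; have : 0 <= n%:R :> R by []; nra.
Qed.

(* Cauchy-Schwarz over the O(4^n) frequencies of the block, in the form
   [2 H <= d + H^2 / d] with [d = e / 2^n]. *)
Lemma lp_block_L2_le : exists K : R, 0 <= K /\ forall u (e : R), 0 < e ->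
  (forall N, \sum_(k <- box N) height u k ^+ 2 <= e ^+ 2) ->
  forall n x, `|lp_block P n u x| <= 2 ^+ n * (K * e).
Proof.
have [kp [kp0 hm]] := lp_mult_supp P.
(* At most ((2 kp + 1) 2^n)^2 frequencies with d = e / 2^n each give the square; the sum of H^2 / d
   is at most 2^n e and gives the 1. *)
exists ((2 * kp).+1%:R ^+ 2 + 1); split; first by rewrite addr_ge0 ?sqr_ge0.
move=> u e e0 he n x; have nB : in_box P n (kp * 2 ^ n) by move=> k /hm[].
rewrite (lp_block_box _ _ nB); apply: (le_trans (ler_norm_sum _ _ _)).
have p0 : 0 < 2 ^+ n :> R by rewrite exprn_gt0.
pose d := e / 2 ^+ n; have d0 : 0 < d by rewrite divr_gt0.
apply: (@le_trans _ _ (\sum_(k <- box (kp * 2 ^ n)) (d + height u k ^+ 2 / d))).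
  apply: ler_sum => k _; rewrite normrM (ger0_norm (lp_mult_ge0 _ _ _)).
  apply: (@le_trans _ _ (1 * height u k)).
    by apply: ler_pM; rewrite ?lp_mult_ge0 ?lp_mult_le1 ?le_mode.
  have H0 := height_ge0 u k; rewrite mul1r -(ler_pM2r d0) [leRHS]mulrDl divfK ?lt0r_neq0//.
  by have := sqr_ge0 (height u k - d); have := mulr_ge0 H0 (ltW d0); lra.
have -> : 2 ^+ n * (((2 * kp).+1%:R ^+ 2 + 1) * e) =
    2 ^+ n * ((2 * kp).+1%:R ^+ 2 * e) + 2 ^+ n * e by ring.
rewrite big_split/=; apply: lerD.
  rewrite big_const_seq count_predT iter_addr_0 size_box -[leLHS]mulr_natl.
  rewrite /d mulrA ler_pdivrMr// -natrX.
  rewrite (_ : _ * _ * _ = ((2 * kp).+1%:R * 2 ^+ n) ^+ 2 * e); last by rewrite natrX; ring.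
  rewrite ler_pM2r// -natrX -natrM -natrX ler_nat leq_sqr.
  have : (0 < 2 ^ n)%N by rewrite expn_gt0.
  nia.
rewrite -mulr_suml ler_pdivrMr// (le_trans (he _))//.
have -> : 2 ^+ n * e * d = e ^+ 2 by rewrite /d; field; exact: lt0r_neq0.
by [].
Qed.

Lemma besov_norm_height_lt alpha : 2 / 3 < alpha < 1 -> exists K : R, 0 < K /\
  forall u (e : R), 0 < e ->
  (forall N, \sum_(k <- box N) height u k ^+ 2 <= e ^+ 2) ->
  (besov_norm P (alpha - 2) u <= (K * e)%:E)%E.
Proof.
move=> ha; have [K [K0 h]] := lp_block_L2_le.
(* The 1 makes the constant positive, so that one may divide by it. *)
exists (4 * K + 1); split; first by rewrite ltr_wpDl// mulr_ge0.
move=> u e e0 he; apply: (@le_trans _ _ (4 * (K * e))%:E).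
  by apply: besov_norm_le_L2 => //; [exact: h|exact: ltW].
by rewrite lee_fin; have := ltW e0; lra.
Qed.

End BesovBounds.

(** * Enhanced pairs *)

Section Pairs.
Variables (R : realType) (P : dyadic_partition R) (alpha : R).
Hypothesis halpha : 2 / 3 < alpha < 1.
Implicit Types (u g w : distr R) (k : int * int) (n N : nat) (x : R * R).
Local Notation mR2 := (measurableTypeR R * measurableTypeR R)%type.
Local Notation tau := (@tau R).

Lemma besov_fin_num (beta : R) u (e : R) : (besov_norm P beta u <= e%:E)%E ->
  besov_norm P beta u \is a fin_num.
Proof.
move=> h; rewrite ge0_fin_numE ?(le_lt_trans h) ?ltry//.
apply: le_trans (ereal_sup_ubound (ex_intro2 _ _ 0%N I erefl)).
by rewrite mule_ge0 ?Lnorm_ge0// lee_fin powR_ge0.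
Qed.

Lemma enhanced_exists h : L2_zero_mean h -> exists p : pair_space P alpha,
  enhanced P h (besov_distr p.1) (besov_distr p.2).
Proof.
move=> [hh hz]; have [u hu] := L2_distr hh.
have hb := L2_height_bound hh hu; have u0 := height0 hu hz.
have [g ug] := green_exists hb; have [w hw] := reson_exists P hb u0 ug.
have [E hE] := hb.
have fu : besov_norm P (alpha - 2) u \is a fin_num.
  have [K [K0 hK]] := besov_norm_height_lt P halpha.
  have E0 : 0 <= E by apply: le_trans (hE 0%N); apply: sumr_ge0 => k _; exact: sqr_ge0.
  (* The bound must be a square of a positive number: E <= (E + 1)^2. *)
  apply: (besov_fin_num (hK u (E + 1) _ _)) => [|N]; first by rewrite ltr_wpDl.
  by apply: (le_trans (hE N)); nra.
have fw : besov_norm P (2 * alpha - 2) w \is a fin_num.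
  have [C [C0 hC]] := lp_block_reson_le P.
  exact: besov_fin_num (besov_norm_le_reson halpha (hC _ _ _ _ ug hw u0 hE)).
by exists (Besov fu, Besov fw); split => //; exists g.
Qed.

Lemma L2_pairs_closure : L2_pairs P alpha `<=` closure (smooth_pairs P alpha).
Proof.
move=> p [h [hh hz] [hu [g ug hw]]] B Bp.
have [e e0 eB] : exists2 e : R, 0 < e & ball p e `<=` B.
  by have /nbhs_ballP[e e0 eB] := Bp; exists e.
have hb := L2_height_bound hh hu; have u0 := height0 hu hz.
have [K [K0 hK]] := besov_norm_height_lt P halpha.
have d0 : 0 < e / (2 * K) by rewrite divr_gt0// mulr_gt0.
have [r1 hr1] := height_bound_tail hb (exprn_gt0 2 d0).
have e4 : 0 < e / 4 by rewrite divr_gt0.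
have [r2 hr2] := lp_block_reson_cut ug hw u0 hb e4.
(* One truncation, beyond both thresholds, serves both components; each of the two distances is then
   at most e / 2. *)
have [theta [u' [th2 thz hu' cu]]] := cut_exists (maxn r1 r2) hz hu.
have [p' [hp1 [g' ug' hw']]] := enhanced_exists (conj th2 thz).
(* [u'] and the first component of [p'] both represent [theta], so their coefficients agree. *)
have cp : cut (maxn r1 r2) (besov_distr p.1) (besov_distr p'.1).
  by move=> k; have := cu k; rewrite /cosc /sinc !hu' !hp1.
exists p'; split.
  exists theta, 0, (besov_distr p'.2); split => //; first by split => //; exists g'.
  move=> phi; under eq_Rintegral do rewrite mul0r.
  by rewrite tint0 subr0.
apply: eB; split.
  rewrite /ball /= /besov_ball; apply: (@le_lt_trans _ _ (K * (e / (2 * K)))%:E).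
    apply: hK => // N; apply: le_trans (hr1 N); rewrite [leRHS]big_mkcond.
    apply: ler_sum => k _; rewrite (height_cut _ cp).
    case: ifP => [hk|_]; first by rewrite ifT// (leq_trans (leq_maxl _ r2))// ltnW.
    by rewrite expr0n/=; case: ifP => // _; exact: sqr_ge0.
  rewrite lte_fin (_ : _ * _ = e / 2); last by field; exact: lt0r_neq0.
  by rewrite ltr_pdivrMr// ltr_pMr// ltr1n.
rewrite /ball /= /besov_ball; apply: (@le_lt_trans _ _ (2 * (e / 4))%:E).
  by apply: besov_norm_le_reson => //; exact: hr2 (leq_maxr _ _) cp ug' hw'.
rewrite lte_fin (_ : _ * _ = e / 2); last by field.
by rewrite ltr_pdivrMr// ltr_pMr// ltr1n.
Qed.

(** Only l = k and l = -k contribute, and since [sinc] is odd the second case also gives cosc^2 +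
    sinc^2. *)
Lemma mode_int_ge0 u k l : 0 <= \int[torus R]_x (mode u k x * mode u l x).
Proof.
have t0 : 0 <= tau / 2 by rewrite ltW// divr_gt0// tau_gt0.
rewrite /mode int_trigM; apply: mulr_ge0 => //; apply: addr_ge0.
  case: eqP => // /eqP; rewrite addr_eq0 => /eqP ->; rewrite coscN sincN.
  have := sqr_ge0 (cosc u l); have := sqr_ge0 (sinc u l); lra.
case: eqP => // /eqP; rewrite subr_eq0 => /eqP ->.
have := sqr_ge0 (cosc u l); have := sqr_ge0 (sinc u l); lra.
Qed.

Lemma cos_test0 x : cos_test R 0 x = 1.
Proof. by rewrite /= /trig angle0 cos0 sin0 mulr0 addr0 mulr1. Qed.

(* The mean of [h o Kh] is a sum of squares. *)
Lemma resonating_mean_ge0 u g w : inverse_laplacian u g -> resonating P u g w ->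
  0 <= w (cos_test R 0).
Proof.
move=> ug hw; have [Bf cw] := resonating_dsum ug hw.
have cw0 := cw (cos_test R 0).
rewrite -(cvg_lim (@Rhausdorff R) cw0); apply: limr_ge; first exact: cvgP cw0.
apply: nearW => N; rewrite tint_dsum; apply: sumr_ge0 => k _; apply: sumr_ge0 => l _.
rewrite mulr_ge0 ?reson_wt_ge0// mulr_ge0 ?lam_ge0//.
by under eq_Rintegral do rewrite cos_test0 mulr1; exact: mode_int_ge0.
Qed.

(** Integration keeps the frequency 0 alone, where the multiplier of block 0 equals 1. *)
Lemma tint_lp_block0 u : \int[torus R]_x lp_block P 0 u x = u (cos_test R 0).
Proof.
have [N nN] := in_box_exists P 0.
under eq_Rintegral do rewrite (lp_block_box _ _ nN).
rewrite tint_sum => [|k]; last exact/intgZ/intg_cont/continuous_mode.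
transitivity (\sum_(k <- box N) if k == 0 then u (cos_test R 0) else 0); last first.
  by rewrite (@sum_box1 R N 0 (fun=> u (cos_test R 0))).
apply: eq_bigr => k _; rewrite tintZ; last exact/intg_cont/continuous_mode.
rewrite /mode int_trig; case: eqP => [->|_]; last by rewrite mulr0.
by rewrite lp_mult00 mul1r /cosc mulVKf// lt0r_neq0// tau_gt0.
Qed.

(** Block 0 has weight 2^(-beta) >= 1, so its sup norm is below 1 and its integral below the area
    [tau]. *)
Lemma mean_le_besov (beta : R) u : beta <= 0 -> (besov_norm P beta u < 1%:E)%E ->
  `|u (cos_test R 0)| < tau.
Proof.
move=> b0 hb; set L := ('N[torus R]_+oo [EFin \o (lp_block P 0 u : mR2 -> R)])%E.
have L1 : (L < 1%:E)%E.
  apply: le_lt_trans hb; apply: le_trans (ereal_sup_ubound (ex_intro2 _ _ 0%N I erefl)).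
  rewrite -[leLHS]mul1e lee_wpmul2r ?Lnorm_ge0// lee_fin.
  rewrite -[leLHS](powRr0 2); apply: ler_powR; first by rewrite ler1n.
  by rewrite sub0r mulN1r oppr_ge0.
have L0 : (0 <= L)%E by exact: Lnorm_ge0.
have LE : L = (fine L)%:E by rewrite fineK// ge0_fin_numE// (lt_le_trans L1)// leey.
have I0 : intg (lp_block P 0 u).
  have [N nN] := in_box_exists P 0.
  rewrite (_ : lp_block P 0 u = fun x => \sum_(k <- box N) lp_mult P 0 k * mode u k x).
    by apply: intg_sum => k; exact/intgZ/intg_cont/continuous_mode.
  by apply/funext => x; exact: lp_block_box.
have f0 : 0 <= fine L by exact: fine_ge0.
rewrite -tint_lp_block0; apply: (le_lt_trans (tint_Lnormy I0 f0 _)).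
  by rewrite -LE.
rewrite -[ltRHS]mulr1 ltr_pM2l ?tau_gt0//.
by move: L1; rewrite LE lte_fin.
Qed.

Lemma smooth_pair_not_L2 : exists2 p : pair_space P alpha,
  smooth_pairs P alpha p & ~ closure (L2_pairs P alpha) p.
Proof.
have c1 : continuous ((fun=> -1) : R * R -> R) by move=> x; exact: cvg_cst.
have [v hv] := L2_distr (continuous_Lfun2 c1).
have vE k (a b : R) : v (trig_test k a b) = if k == 0 then - (tau * a) else 0.
  rewrite hv; have -> : \int[torus R]_x (-1 * trig_test k a b x) =
      -1 * \int[torus R]_x (trig k a b x).
    by rewrite tintZ//; apply/intg_cont/continuous_trig.
  by rewrite int_trig mulN1r; case: eqP => // _; rewrite oppr0.
have vM k x : mode v k x = if k == 0 then -1 else 0.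
  have t0 := lt0r_neq0 (tau_gt0 R).
  rewrite /mode /cosc /sinc.
  rewrite -[cos_test R k]/(trig_test k 1 0) -[sin_test R k]/(trig_test k 0 1) !vE.
  case: eqP => [->|_]; rewrite /trig; last by rewrite !mulr0 !mul0r addr0.
  by rewrite angle0 cos0 sin0; field.
have fv : besov_norm P (2 * alpha - 2) v \is a fin_num.
  apply: (besov_fin_num (besov_norm_le_reson (e := 1) halpha _)) => n x.
  have [N nN] := in_box_exists P n; rewrite (lp_block_box _ _ nN).
  under eq_bigr do rewrite vM.
  rewrite (eq_bigr (fun k => if k == 0 then - lp_mult P n k else 0)); last first.
    by move=> k _; case: eqP => _; rewrite ?mulr0 ?mulrN1.
  by rewrite sum_box1 /= normrN ger0_norm ?lp_mult_ge0// lp_mult_le1.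
have f0 : besov_norm P (alpha - 2) (0 : distr R) \is a fin_num by rewrite besov_norm0.
pose p : pair_space P alpha := (Besov f0, Besov fv).
exists p.
  exists 0, 1, 0; split.
  - by rewrite /zero_mean -[RHS](tint0 R); apply: eq_Rintegral.
  - split.
      move=> phi; rewrite -[LHS]/(0 : R) -[LHS](tint0 R).
      by apply: eq_Rintegral => x _; rewrite -[X in X * _]/(0 : R) mul0r.
    exists 0; first by apply/inverse_laplacianP => k; rewrite /cosc /sinc
      -[X in _ * X]/(0 : R) !mulr0.
    have b0 n x : lp_block P n 0 x = 0 by have := lp_blockB P n 0 0 x; rewrite !subrr.
    move=> phi; rewrite -[X in _ --> X]/(0 : R).
    rewrite (_ : (fun N => _) = fun=> 0); first exact: cvg_cst.
    apply/funext => N; rewrite -[RHS](tint0 R); apply: eq_Rintegral => x _.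
    by rewrite big1 ?mul0r// => i _; apply: big1 => j _; rewrite !b0 mul0r.
  - move=> phi; rewrite -[besov_distr p.2]/v hv -[X in X - _]/(0 : R) sub0r.
    rewrite -[RHS]mulN1r -tintZ; last first.
      by apply: intgZ; apply/intg_cont/continuous_test.
    by apply: eq_Rintegral => x _; rewrite mul1r.
(* Within distance 1 the integral of the second component differs by less than [tau] from that of
   -1, which is -[tau]; it would be negative, against [resonating_mean_ge0]. *)
move=> /(_ (ball p 1) (nbhsx_ballx _ _ ltr01))[q [[h _ [_ [g ug hw]]] [_]]].
rewrite /ball /= /besov_ball => hb.
have b0 : 2 * alpha - 2 <= 0 by case/andP: halpha => *; lra.
have := mean_le_besov b0 hb; have := resonating_mean_ge0 ug hw.
have -> : (v - besov_distr q.2 : distr R) (cos_test R 0) =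
  v (cos_test R 0) - besov_distr q.2 (cos_test R 0) by [].
rewrite -[v _]/(v (trig_test 0 1 0)) vE eqxx mulr1 => w0.
have t0 := tau_gt0 R.
by rewrite ltr_norml => /andP[]; lra.
Qed.

End Pairs.

(** [L2_pairs] collects the pairs whose resonating term exists; the first conjunct says that every
    [h] with [L2_zero_mean h] yields one. *)
Theorem lemma3p14 (R : realType) (P : dyadic_partition R) (alpha : R)
    (halpha : 2 / 3 < alpha < 1) :
  (forall h, L2_zero_mean h -> exists p : pair_space P alpha,
     enhanced P h (besov_distr p.1) (besov_distr p.2)) /\
  closure (L2_pairs P alpha) `<` closure (smooth_pairs P alpha).
Proof.
split; first by move=> h; exact: enhanced_exists.
split.
  rewrite [X in _ `<=` X](closure_id _).1; last exact: closed_closure.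
  exact/closureS/L2_pairs_closure.
have [p sp nL] := smooth_pair_not_L2 P halpha.
by move=> /(_ p (subset_closure sp)).
Qed.
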